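(* Let $\theta>0$, $\theta\ne1$, let $M\ge1$ and $N\ge2$ be integers, and let $\mathbb P^\theta_N$ be the probability measure on pairs $(\ell,m)$ described in the context, with positive weights $w$ and $\tau$. Let $\mathcal M\subseteq\mathbb C$ be open with $[0,M+1+(N-1)\theta]\subset\mathcal M$. Suppose there exist six functions $\phi^t_i,\phi^b_i,\phi^m_i$, $i=1,2$, analytic in $\mathcal M$, such that $$\frac{\phi_1^t(z)}{\phi_1^m(z)}=\frac{w(z-1)}{w(z)},\quad \frac{\phi_1^b(\hat z)}{\phi_1^m(\hat z)}=\frac{\tau(\hat z)}{\tau(\hat z-1)},\quad \frac{\phi_2^t(z)}{\phi_2^m(z)}=\frac{w(z)}{w(z-1)},\quad \frac{\phi_2^b(\hat z-\theta)}{\phi_2^m(\hat z-\theta)}=\frac{\tau(\hat z-1)}{\tau(\hat z)}$$ for all $z\in[1,M+(N-1)\theta]$ and $\hat z\in[\theta+1,M+(N-1)\theta]$. Suppose in addition that, with $s_N=M+1+(N-1)\theta$, $$\phi_1^t(0)=\phi_1^b(s_N)=\phi_1^m(s_N)=\phi_2^t(s_N)=\phi_2^m(0)=\phi_2^b(0)=0.$$ Define $$R_1(z)=\phi_1^t(z)\,\mathbb E\Big[\prod_{i=1}^N\frac{z-\ell_i-\theta}{z-\ell_i}\Big]+\phi_1^b(z)\,\mathbb E\Big[\prod_{i=1}^{N-1}\frac{z-m_i+\theta-1}{z-m_i-1}\Big]+\frac{\theta}{1-\theta}\,\phi_1^m(z)\,\mathbb E\Big[\prod_{i=1}^N\frac{z-\ell_i-\theta}{z-\ell_i-1}\prod_{i=1}^{N-1}\frac{z-m_i+\theta-1}{z-m_i}\Big],$$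 $$R_2(z)=\phi_2^t(z)\,\mathbb E\Big[\prod_{i=1}^N\frac{z-\ell_i+\theta-1}{z-\ell_i-1}\Big]+\phi_2^b(z)\,\mathbb E\Big[\prod_{i=1}^{N-1}\frac{z-m_i}{z-m_i+\theta}\Big]+\frac{\theta}{1-\theta}\,\phi_2^m(z)\,\mathbb E\Big[\prod_{i=1}^N\frac{z-\ell_i+\theta-1}{z-\ell_i}\prod_{i=1}^{N-1}\frac{z-m_i}{z-m_i+\theta-1}\Big],$$ where $\mathbb E$ is expectation with respect to $\mathbb P^\theta_N$. Then $R_1(z)$ and $R_2(z)$ are analytic in $\mathcal M$ (i.e. all their apparent poles are removable).
   Context: **The measure.** For integers $N\ge2$, $M\ge1$ and $\theta>0$, the state space is the finite set of pairs $(\ell,m)$, $\ell=(\ell_1,\dots,\ell_N)$, $m=(m_1,\dots,m_{N-1})$, with $\ell_i=\lambda_i+(N-i)\theta$, $m_i=\mu_i+(N-i)\theta$, where $\lambda_i,\mu_i\in\mathbb Z$ and $M\ge\lambda_1\ge\mu_1\ge\lambda_2\ge\cdots\ge\mu_{N-1}\ge\lambda_N\ge0$. Let $w(x)=w(x;N)$ be a positive function on $[0,M+(N-1)\theta]$ and $\tau(x)=\tau(x;N)$ a positive function on $[\theta,M+(N-1)\theta]$. The measure is $$\mathbb P^\theta_N(\ell,m)=Z_N^{-1}H^t(\ell)H^b(m)I(\ell,m),$$ with $Z_N$ a normalization constant and $$H^t(\ell)=\prod_{1\le i<j\le N}\frac{\Gamma(\ell_i-\ell_j+1)}{\Gamma(\ell_i-\ell_j-\theta+1)}\prod_{i=1}^Nw(\ell_i),\qquad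 H^b(m)=\prod_{1\le i<j\le N-1}\frac{\Gamma(m_i-m_j+\theta)}{\Gamma(m_i-m_j)}\prod_{i=1}^{N-1}\tau(m_i),$$ $$I(\ell,m)=\prod_{1\le i<j\le N}\frac{\Gamma(\ell_i-\ell_j-\theta+1)}{\Gamma(\ell_i-\ell_j)}\prod_{1\le i<j\le N-1}\frac{\Gamma(m_i-m_j+1)}{\Gamma(m_i-m_j+\theta)}\prod_{1\le i<j\le N}\frac{\Gamma(m_i-\ell_j)}{\Gamma(m_i-\ell_j-\theta+1)}\prod_{1\le i\le j\le N-1}\frac{\Gamma(\ell_i-m_j+\theta)}{\Gamma(\ell_i-m_j+1)}.$$ *)

(* Defs.v *)
From HB Require Import structures.
From mathcomp Require Import all_boot all_order all_algebra complex.
From mathcomp Require Import all_classical all_reals all_analysis.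

Set Implicit Arguments.
Unset Strict Implicit.
Unset Printing Implicit Defensive.

Import Order.TTheory GRing.Theory Num.Theory.
Import numFieldNormedType.Exports.

Local Open Scope classical_set_scope.
Local Open Scope ring_scope.
Local Open Scope complex_scope.

(* The type R[i] seen as a numFieldType, which is what gives it the topology
   of its norm. *)
Notation Cplx R := ((R[i] : numFieldType) : Type).

(* Euler's integral. It is the Gamma function for x > 0 only; every argument
   at which it is used below is positive on the state space. *)
Definition Gamma (R : realType) (x : R) : R :=
  (\int[lebesgue_measure]_(t in `]0%R, +oo[) (t `^ (x - 1) * expR (- t)))%R.

Definition analytic_at (R : realType) (f : Cplx R -> Cplx R) (z0 : Cplx R) :
    Prop :=
  exists a : nat -> Cplx R,
    \forall z \near z0, series (fun k => a k * (z - z0) ^+ k) @ \oo --> f z.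

Definition analytic_in (R : realType) (U : set (Cplx R))
    (f : Cplx R -> Cplx R) : Prop :=
  forall z, U z -> analytic_at f z.

(* P is the set of apparent poles of the formula for f: because x / 0 = 0, the
   values of f at the points of P are meaningless and are not used. *)
Definition analytic_up_to_removable (R : realType) (U P : set (Cplx R))
    (f : Cplx R -> Cplx R) : Prop :=
  exists g : Cplx R -> Cplx R,
    analytic_in U g /\ (forall z, U z -> ~ P z -> g z = f z).

(* Pairs (lambda, mu); the constraints 0 <= lambda_i, mu_i <= M, which follow
   from the interlacing chain, are built into 'I_M.+1. Indices start at 0. *)
Definition state (N M : nat) : Type :=
  ({ffun 'I_N -> 'I_M.+1} * {ffun 'I_N.-1 -> 'I_M.+1})%type.

HB.instance Definition _ (N M : nat) := Finite.on (state N M).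

Definition interlacing (N M : nat) (s : state N M) : bool :=
  [forall i : 'I_N, forall j : 'I_N.-1,
     ((i == j :> nat) ==> (s.2 j <= s.1 i)%N) &&
     ((i == j.+1 :> nat) ==> (s.1 i <= s.2 j)%N)].

Section Measure.

Variables (R : realType) (N M : nat) (theta : R) (w tau : R -> R).
Implicit Type s : state N M.

(* The index i : 'I_N stands for i.+1 in the one-based convention. *)
Definition ell s (i : 'I_N) : R :=
  (s.1 i)%:R + (N - i.+1)%N%:R * theta.

Definition emm s (i : 'I_N.-1) : R :=
  (s.2 i)%:R + (N - i.+1)%N%:R * theta.

Definition Htop s : R :=
  (\prod_(i < N) \prod_(j < N | (i < j)%N)
     (Gamma (ell s i - ell s j + 1) / Gamma (ell s i - ell s j - theta + 1)))
  * \prod_(i < N) w (ell s i).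

Definition Hbot s : R :=
  (\prod_(i < N.-1) \prod_(j < N.-1 | (i < j)%N)
     (Gamma (emm s i - emm s j + theta) / Gamma (emm s i - emm s j)))
  * \prod_(i < N.-1) tau (emm s i).

Definition Iint s : R :=
  (\prod_(i < N) \prod_(j < N | (i < j)%N)
     (Gamma (ell s i - ell s j - theta + 1) / Gamma (ell s i - ell s j)))
  * (\prod_(i < N.-1) \prod_(j < N.-1 | (i < j)%N)
       (Gamma (emm s i - emm s j + 1) / Gamma (emm s i - emm s j + theta)))
  * (\prod_(i < N.-1) \prod_(j < N | (i < j)%N)
       (Gamma (emm s i - ell s j) / Gamma (emm s i - ell s j - theta + 1)))
  * (\prod_(i < N) \prod_(j < N.-1 | (i <= j)%N)
       (Gamma (ell s i - emm s j + theta) / Gamma (ell s i - emm s j + 1))).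

Definition weight s : R := Htop s * Hbot s * Iint s.

Definition partition_function : R :=
  \sum_(s : state N M | interlacing s) weight s.

Definition prob s : R := weight s / partition_function.

Definition expect (f : state N M -> Cplx R) : Cplx R :=
  \sum_(s : state N M | interlacing s) (prob s)%:C * f s.

Definition R1 (phit phib phim : Cplx R -> Cplx R) (z : Cplx R) : Cplx R :=
  phit z * expect (fun s =>
    \prod_(i < N) ((z - (ell s i)%:C - theta%:C) / (z - (ell s i)%:C)))
  + phib z * expect (fun s =>
    \prod_(i < N.-1)
      ((z - (emm s i)%:C + theta%:C - 1) / (z - (emm s i)%:C - 1)))
  + (theta / (1 - theta))%:C * phim z * expect (fun s =>
    (\prod_(i < N)
      ((z - (ell s i)%:C - theta%:C) / (z - (ell s i)%:C - 1)))
    * \prod_(i < N.-1)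
      ((z - (emm s i)%:C + theta%:C - 1) / (z - (emm s i)%:C))).

Definition R2 (phit phib phim : Cplx R -> Cplx R) (z : Cplx R) : Cplx R :=
  phit z * expect (fun s =>
    \prod_(i < N)
      ((z - (ell s i)%:C + theta%:C - 1) / (z - (ell s i)%:C - 1)))
  + phib z * expect (fun s =>
    \prod_(i < N.-1)
      ((z - (emm s i)%:C) / (z - (emm s i)%:C + theta%:C)))
  + (theta / (1 - theta))%:C * phim z * expect (fun s =>
    (\prod_(i < N)
      ((z - (ell s i)%:C + theta%:C - 1) / (z - (ell s i)%:C)))
    * \prod_(i < N.-1)
      ((z - (emm s i)%:C) / (z - (emm s i)%:C + theta%:C - 1))).

(* The zeros of the denominators in R1 and in R2. *)
Definition R1_poles : set (Cplx R) :=
  [set z | exists2 s, interlacing s &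
     (exists i, z = (ell s i)%:C \/ z = (ell s i + 1)%:C) \/
     (exists i, z = (emm s i)%:C \/ z = (emm s i + 1)%:C)].

Definition R2_poles : set (Cplx R) :=
  [set z | exists2 s, interlacing s &
     (exists i, z = (ell s i)%:C \/ z = (ell s i + 1)%:C) \/
     (exists i, z = (emm s i - theta)%:C \/ z = (emm s i - theta + 1)%:C)].

End Measure.

(* Main.v *)
Require Import Defs.
From mathcomp Require Import all_boot all_order all_algebra complex.
From mathcomp Require Import all_classical all_reals all_analysis.
From mathcomp Require Import measurable_realfun.
From mathcomp Require Import ring lra zify.

Set Implicit Arguments.
Unset Strict Implicit.
Unset Printing Implicit Defensive.

Import Order.TTheory GRing.Theory Num.Theory.
Import numFieldNormedType.Exports.

Local Open Scope classical_set_scope.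
Local Open Scope ring_scope.
Local Open Scope complex_scope.

(** Each of the three expectations in [R1] is an average of rational functions of
[z], so the point is that their residues, weighted by [phit], [phib] and [phim],
add up to zero at every apparent pole.

Partial fractions. For a fixed configuration each product has simple poles only,
and expands with explicit residues. In the third product [ell i + 1] and [emm j]
may coincide, but then the numerator has a double zero there
([coincidence]), so that the expansion still holds, the two terms being zero
([partial_fractions_fin], [prod_midE]). Hence [R1] is an analytic function plus a
finite sum of terms [G z / (z - a)] with [G] analytic
([observable_decomposition]), and it suffices that [G] vanish at [a]
([aur_div], [observable_aur]).

Cancellation. The Gamma functions in the weight collapse, by the functional
equation [GammaS], so that the weights of two configurations that differ by a
unit move of one particle have a rational ratio ([weight_admissible]). With the
relations between [phit], [phib], [phim] and the ratios of [w] and [tau], this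
gives three cancellations at a point [a] ([cancel_top_mid], [cancel_mid_bot],
[cancel_top_bot]):
- the residue of the first product at [ell i = a] against that of the third one
  for the configuration with [ell i = a - 1];
- the residue of the third product at [emm j = a] against that of the second one
  for the configuration with [emm j = a - 1];
- when [ell i = emm i = a], the residue of the first product against that of the
  second one for the configuration where both particles are at [a - 1].
A move that is blocked by a neighbouring particle meets a vanishing factor of the
residue, and one that would leave the state space meets a zero of [phit], [phib]
or [phim]. Everything cancels already for each index [i] separately
([residue_sum_eq0]).

The function [R2] is [R1] for the reflected measure ([R2E]), which satisfies the
same relations ([admissible_refl]). *)

(** * Power series expansions *)

Section PowerSeries.
Variable K : numFieldType.
Implicit Types (f g : K -> K) (z a : K).

(** Expansion in a power series around [z0], over any numeric field; over the
complex numbers it is [analytic_at]. *)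
Definition has_expansion f z0 := exists c : nat -> K,
  \forall z \near z0, series (fun k => c k * (z - z0) ^+ k) @ \oo --> f z.

Lemma has_expansion_near f g z0 : (\forall z \near z0, f z = g z) ->
  has_expansion f z0 -> has_expansion g z0.
Proof. by move=> fg [c hc]; exists c; apply: filterS2 fg hc => z <-. Qed.

Lemma has_expansion_cst (c z0 : K) : has_expansion (fun=> c) z0.
Proof.
exists (fun k => c *+ (k == 0)%N); apply: filterE => z.
rewrite -cvg_shiftS; apply: cvg_near_cst; apply: filterE => n.
rewrite /series /= big_nat_recl // big1_seq ?expr0 ?mulr1 ?addr0 // => i _.
by rewrite mul0r.
Qed.

Lemma has_expansion_add f g z0 : has_expansion f z0 -> has_expansion g z0 ->
  has_expansion (fun z => f z + g z) z0.
Proof.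
move=> [c hc] [d hd]; exists (fun k => c k + d k).
apply: filterS2 hc hd => z cz dz.
rewrite (_ : (fun k => _) = (fun k => c k * (z - z0) ^+ k) +
  (fun k => d k * (z - z0) ^+ k)); last first.
  by apply/funext => k; rewrite mulrDl.
by rewrite seriesD; exact: cvgD.
Qed.

Lemma has_expansion_scale (c : K) f z0 : has_expansion f z0 ->
  has_expansion (fun z => c * f z) z0.
Proof.
move=> [d hd]; exists (fun k => c * d k); apply: filterS hd => z dz.
rewrite (_ : series _ = (fun n => c * series (fun k => d k * (z - z0) ^+ k) n)).
  by apply: cvgM; [exact: cvg_cst | exact: dz].
apply/funext => n; rewrite /series /= mulr_sumr.
by apply: eq_bigr => i _; rewrite mulrA.
Qed.

Lemma has_expansion_reflect (c : K) f z0 : has_expansion f (c - z0) ->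
  has_expansion (fun z => f (c - z)) z0.
Proof.
move=> [d hd]; exists (fun k => d k * (-1) ^+ k).
have cont : (fun z : K => c - z) @ z0 --> c - z0.
  exact: (@cvgB K K K (nbhs z0) _ (fun=> c) id c z0 (cvg_cst c) cvg_id).
have := cont _ hd; rewrite nbhs_simpl /=; apply: filterS => z /= dz.
rewrite (_ : (fun k => _) = fun k => d k * (c - z - (c - z0)) ^+ k); last first.
  by apply/funext => k; rewrite -mulrA -exprMn; congr (_ * _ ^+ _); ring.
exact: dz.
Qed.

(** At a zero of f the quotient is expanded by shifting the coefficients. *)
Lemma has_expansion_div_zero f a : has_expansion f a -> f a = 0 ->
  exists d, has_expansion (fun z => if z == a then d else f z / (z - a)) a.
Proof.
move=> [c hc] fa0.
have c0 : c 0%N = 0.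
  have := nbhs_singleton hc; rewrite fa0 => ha.
  suff hb : series (fun k => c k * (a - a) ^+ k) @ \oo --> c 0%N.
    exact: (cvg_unique (@norm_hausdorff K K) hb ha).
  rewrite -cvg_shiftS; apply: cvg_near_cst; apply: filterE => n.
  rewrite /series /= big_nat_recl // expr0 mulr1 big1_seq ?addr0 // => i _.
  by rewrite subrr expr0n mulr0.
exists (c 1%N), (fun k => c k.+1); apply: filterS hc => z cz.
case: eqVneq => [->|za].
  rewrite -cvg_shiftS; apply: cvg_near_cst; apply: filterE => n.
  rewrite /series /= big_nat_recl // expr0 mulr1 big1_seq ?addr0 // => i _.
  by rewrite subrr expr0n mulr0.
have za0 : z - a != 0 by rewrite subr_eq0.
rewrite (_ : series _ =
  (fun n => series (fun k => c k * (z - a) ^+ k) n.+1 * (z - a)^-1)).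
  by apply: cvgM; [rewrite cvg_shiftS; exact: cz | exact: cvg_cst].
apply/funext => n; rewrite /series /= big_nat_recl // c0 mul0r add0r mulr_suml.
by apply: eq_bigr => i _; rewrite exprSr -!mulrA divff // mulr1.
Qed.

Hypothesis cvg_pow : forall t : K, `|t| < 1 -> (fun n => t ^+ n) @ \oo --> (0 : K).

(** Away from [a] the coefficients [b] of the quotient solve
[(h - (a - z0)) * \sum_k b k * h ^+ k = \sum_k c k * h ^+ k], which is a
first-order recursion; a geometric bound on [c] is inherited by [b]. *)
Lemma has_expansion_div_away f a z0 : z0 != a -> has_expansion f z0 ->
  has_expansion (fun z => f z / (z - a)) z0.
Proof.
move=> z0a [c hc].
pose e := a - z0.
have e0 : e != 0 by rewrite subr_eq0 eq_sym.
pose b := fix b n := if n is m.+1 then (b m - c n) / e else - c 0%N / e.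
have [p p0 [C C0 hC]] : exists2 p : K, 0 < p &
    exists2 C : K, 0 <= C & forall k, `|c k| * p ^+ k <= C.
  move/nbhs_ballP : (hc) => [p /= p0 hp].
  exists (p / 2); first by rewrite divr_gt0.
  have : ball z0 p (z0 + p / 2).
    rewrite -ball_normE /= opprD addNKr normrN gtr0_norm ?divr_gt0 //.
    by rewrite ltr_pdivrMr // ltr_pMr // ltr1n.
  move=> /hp hs.
  have /cvg_series_cvg_0 /cvgP /cvg_seq_bounded : 
    cvgn (series (fun k => c k * (z0 + p / 2 - z0) ^+ k)).
    by apply/cvg_ex; exists (f (z0 + p / 2)).
  move=> /pinfty_ex_gt0 [C C0 CC]; exists C; first exact: ltW.
  move=> k; have := CC k I; rewrite /= normrM normrX addrAC subrr add0r.
  by rewrite (gtr0_norm (_ : 0 < p / 2)) // divr_gt0.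
(* [r] lies below both the radius [p], on which the coefficients of [f] are
   under control, and the distance [|e|] to the pole. *)
have e'0 : 0 < `|e| by rewrite normr_gt0.
pose r := p * `|e| / (p + `|e|).
have pe0 : 0 < p + `|e| by rewrite addr_gt0.
have r0 : 0 < r by rewrite divr_gt0 // mulr_gt0.
have rp : r <= p by rewrite ler_pdivrMr // ler_pM2l // lerDr ltW.
have re : r < `|e|.
  by rewrite ltr_pdivrMr // mulrC ltr_pM2l // ltrDl.
have re0 : 0 < `|e| - r by rewrite subr_gt0.
pose B := C / (`|e| - r).
have B0 : 0 <= B by rewrite divr_ge0 // ltW.
have hB n : `|b n| * r ^+ n <= B.
  elim: n => [|n IH].
    rewrite expr0 mulr1 /= normrM normrN normfV.
    apply: (@le_trans _ _ (C / `|e|)).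
      by rewrite ler_pM2r ?invr_gt0 // -[leLHS]mulr1; have := hC 0%N.
    rewrite /B ler_wpM2l // lef_pV2 // ?gerBl ?ltW //.
  rewrite /= normrM normfV -mulrA (mulrC _^-1) mulrA ler_pdivrMr //.
  apply: (@le_trans _ _ ((`|b n| + `|c n.+1|) * r ^+ n.+1)).
    by rewrite ler_wpM2r ?ler_normB // exprn_ge0 // ltW.
  have -> : B * `|e| = B * r + C.
    by rewrite /B -mulrA -{2}(subrK r `|e|) mulrDr addrC; field; rewrite gt_eqF.
  rewrite mulrDl lerD //.
    by rewrite exprSr mulrA ler_wpM2r // ltW.
  apply: le_trans (hC n.+1); apply: ler_wpM2l => //.
  by apply: lerXn2r; rewrite // nnegrE ltW.
exists b; have : \forall z \near z0, `|z0 - z| < r.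
  exact: (@cvgr_dist_lt K K K (nbhs z0) _ id z0 cvg_id r r0).
apply: filterS2 hc => z cz zr.
pose h := z - z0.
have hr : `|h / r| < 1.
  by rewrite normrM normfV (gtr0_norm r0) ltr_pdivrMr // mul1r distrC.
have za0 : z - a != 0.
  rewrite subr_eq0; apply: contraTneq zr => ->.
  by rewrite -real_leNgt ?num_real // ?normr_real ?gtr0_real // distrC ltW.
have sumE n : series (fun k => b k * h ^+ k) n.+1 =
    (series (fun k => c k * h ^+ k) n.+1 + b n * h ^+ n.+1) * (z - a)^-1.
  apply: (canRL (mulfK za0)).
  have -> : z - a = h - e by rewrite /h /e; ring.
  elim: n => [|n IH].
    by rewrite /series /= !big_nat1 !expr0 expr1 /b; field.
  rewrite seriesSr [X in _ = X + _]seriesSr mulrDl IH /= !exprS.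
  by field.
rewrite -cvg_shiftS.
rewrite (_ : [sequence _]_n = fun n => (series (fun k => c k * h ^+ k) n.+1 +
    b n * h ^+ n.+1) * (z - a)^-1); last by apply/funext => n; exact: sumE.
apply: cvgM; last exact: cvg_cst.
rewrite -[f z]addr0; apply: cvgD; first by rewrite cvg_shiftS.
apply/cvgr0Pnorm_lt => eps eps0.
have d0 : 0 < eps / ((B + 1) * (`|h| + 1)).
  by rewrite divr_gt0 // mulr_gt0 // ltr_wpDl.
have := cvg_pow hr => /cvgr0Pnorm_lt /(_ _ d0).
apply: filterS => n; rewrite ltr_pdivlMr; last by rewrite mulr_gt0 // ltr_wpDl.
apply: le_lt_trans.
have -> : b n * h ^+ n.+1 = (h / r) ^+ n * (b n * r ^+ n * h).
  by rewrite exprMn exprVn exprS; field; rewrite expf_neq0 // gt_eqF.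
rewrite normrM ler_wpM2l // normrM normrM normrX (gtr0_norm r0).
have rn0 : 0 <= r ^+ n by rewrite exprn_ge0 // ltW.
apply: ler_pM; rewrite ?mulr_ge0 ?lerDl //.
by apply: le_trans (hB n) _; rewrite lerDl.
Qed.
End PowerSeries.

(** In lemma names, [aur] stands for [analytic_up_to_removable]. *)
Section RemovablePoles.
Variable R : realType.
Let K : numFieldType := R[i].
Implicit Types (f g : Cplx R -> Cplx R) (U P Q : set (Cplx R)).

(** The norm of a complex number is a complex number on the real line, where the
convergence of geometric sequences is known. *)
Lemma complex_cvg_pow (t : K) : `|t| < 1 -> (fun n => t ^+ n) @ \oo --> (0 : K).
Proof.
have realP (x : K) : 0 <= x -> exists2 r : R, x = r%:C & 0 <= r.
  by case: x => a b; rewrite lecE /= => /andP[/eqP -> a0]; exists a.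
have [s ts s0] := realP _ (normr_ge0 t).
rewrite ts ltcR => s1.
apply/cvgr0Pnorm_lt => e e0.
have [r er _] := realP _ (ltW e0).
have r0 : 0 < r by rewrite -ltcR -er.
have : (GRing.exp s : R ^nat) @ \oo --> 0 by apply: cvg_expr; rewrite ger0_norm.
move=> /cvgr0Pnorm_lt /(_ _ r0); apply: filterS => n.
by rewrite ger0_norm ?exprn_ge0 // normrX ts er -rmorphXn /= ltcR.
Qed.

Lemma aur_analytic U f : analytic_in U f -> analytic_up_to_removable U set0 f.
Proof. by move=> hf; exists f. Qed.

Lemma aur_sub U P Q f g : analytic_up_to_removable U P f -> P `<=` Q ->
  (forall z, U z -> ~ Q z -> f z = g z) -> analytic_up_to_removable U Q g.
Proof.
move=> [h [ha hf]] PQ fg; exists h; split => // z Uz Qz.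
by rewrite -fg // hf // => /PQ.
Qed.

Lemma aur_add U P f g : analytic_up_to_removable U P f ->
  analytic_up_to_removable U P g ->
  analytic_up_to_removable U P (fun z => f z + g z).
Proof.
move=> [f' [fa ff]] [g' [ga gg]]; exists (fun z => f' z + g' z); split.
  by move=> z Uz; apply: (@has_expansion_add K); [exact: fa|exact: ga].
by move=> z Uz Pz; rewrite ff // gg.
Qed.

Lemma aur_sum U P (I : Type) (r : seq I) (F : I -> Cplx R -> Cplx R) :
  (forall i, analytic_up_to_removable U P (F i)) ->
  analytic_up_to_removable U P (fun z => \sum_(i <- r) F i z).
Proof.
move=> hF; elim: r => [|i r IH].
  exists (fun=> 0); split => [z _|z _ _]; last by rewrite big_nil.
  exact: (@has_expansion_cst K).
apply: (aur_sub (aur_add (hF i) IH)) => // z _ _; by rewrite big_cons.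
Qed.

(** A simple pole at a zero of the numerator is removable. *)
Lemma aur_div U f a : analytic_in U f -> U a -> f a = 0 ->
  analytic_up_to_removable U [set a] (fun z => f z / (z - a)).
Proof.
move=> hf Ua fa0.
have [d hd] := @has_expansion_div_zero K f a (hf _ Ua) fa0.
exists (fun z => if z == a then d else f z / (z - a)); split; last first.
  by move=> z _ /eqP /negbTE ->.
move=> z0 Uz0; have [->//|z0a] := eqVneq z0 a.
have := @has_expansion_div_away K complex_cvg_pow f a z0 z0a (hf _ Uz0).
apply: (@has_expansion_near K).
have : \forall z \near (z0 : K), `|z0 - z| < `|z0 - a|.
  apply: (@cvgr_dist_lt K K K (nbhs z0) _ id z0 cvg_id).
  by rewrite normr_gt0 subr_eq0.
apply: filterS => z; case: eqVneq => // ->.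
by rewrite ltxx.
Qed.

Lemma aur_reflect U P (c : Cplx R) f :
  analytic_up_to_removable [set z | U (c - z)] [set z | P (c - z)] f ->
  analytic_up_to_removable U P (fun z => f (c - z)).
Proof.
move=> [g [ga gf]]; exists (fun z => g (c - z)); split.
  move=> z Uz; apply: (@has_expansion_reflect K); apply: ga => /=.
  by rewrite opprB addrC subrK.
by move=> z Uz Pz; rewrite gf //= opprB addrC subrK.
Qed.

Lemma analytic_in_reflect U (c : Cplx R) f : analytic_in U f ->
  analytic_in [set z | U (c - z)] (fun z => f (c - z)).
Proof.
by move=> hf z /= Uz; apply: (@has_expansion_reflect K); exact: hf.
Qed.

Lemma analytic_in_add U f g : analytic_in U f -> analytic_in U g ->
  analytic_in U (fun z => f z + g z).
Proof.
by move=> hf hg z Uz; apply: (@has_expansion_add K); [exact: hf|exact: hg].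
Qed.

Lemma analytic_in_scale U f (c : Cplx R) : analytic_in U f ->
  analytic_in U (fun z => c * f z).
Proof.
by move=> hf z Uz; apply: (@has_expansion_scale K); exact: hf.
Qed.

End RemovablePoles.

(** * Partial fractions *)

Section PartialFractions.
Variable F : fieldType.
Implicit Types (r s : seq F) (z a b : F).

Local Notation N r z := (\prod_(a <- r) (z - a)).

(** The partial fraction expansion of the quotient of the monic polynomials with
roots [r] and [s], as if the elements of [s] were simple poles. *)
Definition pf_sum r s z :=
  1 + \sum_(b <- s) N r b / N (rem b s) b / (z - b).

Lemma pf_sum_perm r r' s s' z : perm_eq r r' -> perm_eq s s' ->
  pf_sum r s z = pf_sum r' s' z.
Proof.
move=> rr ss; rewrite /pf_sum (perm_big _ ss) /=; congr (1 + _).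
apply: eq_big_seq => b bs.
rewrite (perm_big _ rr) /=; congr (_ / _ / _).
apply: perm_big; rewrite -(perm_cons b).
apply: (@perm_trans _ s); last exact: perm_trans ss (perm_to_rem bs).
by rewrite perm_sym perm_to_rem // (perm_mem ss).
Qed.

Lemma root_prod_eq0 r z : z \in r -> N r z = 0.
Proof.
by move=> zr; rewrite (perm_big _ (perm_to_rem zr)) /= big_cons subrr mul0r.
Qed.

(** Induction on the number of factors: the expansion of a product with one
factor less is used twice, at [z] and at the new pole. *)
Lemma partial_fractions_uniq r s z : size r = size s -> uniq s -> z \notin s ->
  N r z / N s z = pf_sum r s z.
Proof.
elim: s r z => [|b s IH] [|a r] z //= => [_ _ _|[szr] /andP[bs us]].
  by rewrite /pf_sum !big_nil divr1 addr0.
rewrite inE negb_or => /andP[zb zs].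
have zb0 : z - b != 0 by rewrite subr_eq0.
have IHz := IH r z szr us zs; have IHb := IH r b szr us bs.
rewrite !big_cons -mulf_div IHz /pf_sum big_cons /= eqxx big_cons.
rewrite -[(b - a) * _ / _]mulrA IHb /pf_sum.
have -> : \sum_(j <- s) \prod_(a0 <- a :: r) (j - a0) /
      \prod_(a0 <- rem j (b :: s)) (j - a0) / (z - j) =
    \sum_(j <- s) (j - a) / (j - b) * (N r j / N (rem j s) j / (z - j)).
  apply: eq_big_seq => j js; have jb : (b == j) = false.
    by apply: contraNF bs => /eqP ->.
  by rewrite /= jb !big_cons -mulf_div !mulrA.
have -> : \sum_(j <- s) (j - a) / (j - b) * (N r j / N (rem j s) j / (z - j)) =
    (z - a) / (z - b) * (\sum_(j <- s) N r j / N (rem j s) j / (z - j)) -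
    (b - a) / (z - b) * (\sum_(j <- s) N r j / N (rem j s) j / (b - j)).
  rewrite !mulr_sumr -sumrB; apply: eq_big_seq => j js.
  have zj0 : z - j != 0 by rewrite subr_eq0; apply: contraNneq zs => ->.
  have bj0 : b - j != 0 by rewrite subr_eq0; apply: contraNneq bs => ->.
  have jb0 : j - b != 0 by rewrite -opprB oppr_eq0.
  move: (N r j / _) => c.
  by field; rewrite zj0 bj0 jb0 zb0.
by field.
Qed.

(** Repeated poles are allowed, provided that the numerator vanishes there to
the same order: the fraction then has no pole at all, and the corresponding
terms of the sum vanish because their numerators do. *)
Lemma partial_fractions r s z : size r = size s -> z \notin s ->
  (forall b, (1 < count_mem b s)%N -> (count_mem b s <= count_mem b r)%N) ->
  N r z / N s z = pf_sum r s z.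
Proof.
move: {2}(size s) (leqnn (size s)) => n.
elim: n r s => [|n IH] r s sn szr zs hc.
  by apply: partial_fractions_uniq => //; case: s sn {szr zs hc}.
have [us|nus] := boolP (uniq s); first exact: partial_fractions_uniq.
have [b cb] : exists b, (1 < count_mem b s)%N.
  move: nus; apply: contraNP => h.
  apply: count_mem_uniq => b; have [bs|bs] := boolP (b \in s); last exact/count_memPn.
  apply/eqP; rewrite eqn_leq -has_count has_pred1 bs andbT leqNgt.
  by apply/negP => c; apply: h; exists b.
have br : b \in r by rewrite -has_pred1 has_count; apply: leq_trans (hc b cb); exact: ltnW.
have bs : b \in s by rewrite -has_pred1 has_count; exact: ltnW.
have pr := perm_to_rem br; have ps := perm_to_rem bs.
set r' := rem b r in pr; set s' := rem b s in ps.
have zb0 : z - b != 0 by rewrite subr_eq0; apply: contraNneq zs => ->.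
have cnt (x t : F) (u v : seq F) : perm_eq u (t :: v) ->
    count_mem x u = ((t == x) + count_mem x v)%N by move=> /permP ->.
have IH' : N r' z / N s' z = pf_sum r' s' z.
  apply: IH.
  - by rewrite -ltnS (leq_trans _ sn) // (perm_size ps).
  - by move: szr; rewrite (perm_size pr) (perm_size ps) /= => -[].
  - by apply: contra zs => zs'; rewrite (perm_mem ps) inE zs' orbT.
  - move=> x c'; have := hc x; rewrite (cnt _ _ _ _ pr) (cnt _ _ _ _ ps).
    by rewrite leq_add2l; apply; rewrite ltn_addl.
rewrite (pf_sum_perm _ pr ps) (perm_big _ pr) (perm_big _ ps) /= !big_cons.
rewrite -mulf_div divff // mul1r IH' /pf_sum big_cons.
have bs' : b \in s'.
  by rewrite -has_pred1 has_count -ltnS; move: cb; rewrite (cnt _ _ _ _ ps) eqxx.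
have br' : b \in r'.
  rewrite -has_pred1 has_count -ltnS.
  by move: (leq_trans cb (hc b cb)); rewrite (cnt _ _ _ _ pr) eqxx.
rewrite big_cons subrr !mul0r add0r; congr (1 + _).
apply: eq_big_seq => j js; rewrite [rem j _]/=.
have [<-|bj] := eqVneq b j; first by rewrite (root_prod_eq0 br') big_cons subrr !mul0r.
rewrite /= ?(negPf bj) !big_cons.
by rewrite -mulf_div divff ?mul1r // subr_eq0 eq_sym.
Qed.

Lemma partial_fractions_fin (I : finType) (alpha beta : I -> F) z :
  (forall i, z != beta i) ->
  (forall b, (1 < #|[pred i | beta i == b]|)%N ->
     (#|[pred i | beta i == b]| <= #|[pred i | alpha i == b]|)%N) ->
  \prod_i ((z - alpha i) / (z - beta i)) =
  1 + \sum_i (beta i - alpha i) *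
    (\prod_(j | j != i) ((beta i - alpha j) / (beta i - beta j))) / (z - beta i).
Proof.
move=> zb hc; rewrite big_split /= prodfV.
have cnt (f : I -> F) b : count_mem b (map f (index_enum I)) = #|[pred i | f i == b]|.
  by rewrite count_map cardE size_filter; apply: eq_count.
have := @partial_fractions (map alpha (index_enum I)) (map beta (index_enum I)) z.
rewrite !size_map !big_map => -> //.
- rewrite /pf_sum; congr (1 + _); rewrite big_map; apply: eq_bigr => i _.
  rewrite big_map (bigD1 i) //=.
  rewrite (perm_big (map beta (rem i (index_enum I)))) /=; last first.
    rewrite -(perm_cons (beta i)) -map_cons.
    apply: (@perm_trans _ (map beta (index_enum I))).
      by rewrite perm_sym perm_to_rem // map_f // mem_index_enum.
    by apply: perm_map; rewrite perm_to_rem // mem_index_enum.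
  rewrite big_map rem_filter ?index_enum_uniq // big_filter /=.
  by rewrite big_split /= prodfV; congr (_ / _); rewrite -mulrA.
- by apply/negP => /mapP [i _ zi]; have := zb i; rewrite zi eqxx.
- by move=> b; rewrite !cnt; exact: hc.
Qed.

End PartialFractions.

(** * The Gamma function *)

Section GammaFunction.
Variable R : realType.
Implicit Types a b t x : R.
Notation mu := (@lebesgue_measure R).

(** Euler's integrand, and its integral with values in the extended reals. *)
Definition gamma_integrand x t : R := t `^ (x - 1) * expR (- t).

Definition gamma_integral x : \bar R :=
  (\int[mu]_(t in `]0%R, +oo[) (gamma_integrand x t)%:E)%E.

Lemma derivable_oo_LR (f f' : R -> R) a b : a < b ->
  (forall t, a <= t <= b -> is_derive t 1 f (f' t)) ->
  derivable_oo_LRcontinuous f a b /\ {in `]a, b[, f^`()%classic =1 f'}.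
Proof.
move=> ab df.
have cf t : a <= t <= b -> f @ t --> f t.
  move=> /df [dft _]; apply: differentiable_continuous.
  exact/derivable1_diffP.
split.
  split.
  - move=> t; rewrite in_itv /= => /andP[at_ tb].
    by case: (df t _); rewrite ?ltW.
  - by apply: cvg_at_right_filter; apply: cf; rewrite lexx ltW.
  - by apply: cvg_at_left_filter; apply: cf; rewrite lexx ltW.
move=> t; rewrite in_itv /= => /andP[at_ tb].
by rewrite derive1E; case: (df t _); rewrite ?ltW.
Qed.

Lemma continuous_within (f f' : R -> R) a b :
  (forall t, a <= t <= b -> is_derive t 1 f (f' t)) ->
  {within `[a, b], continuous f}.
Proof.
move=> df; apply: derivable_within_continuous => t.
by rewrite in_itv /= => /df [].
Qed.

Lemma measurable_gamma_integrand x (D : set R) :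
  measurable_fun D (fun t => (gamma_integrand x t)%:E).
Proof.
apply/measurable_EFinP; apply: measurable_funTS.
apply: measurable_funM.
  exact: measurable_powR.
by apply: measurableT_comp; [exact: measurable_expR | exact: oppr_measurable].
Qed.

Lemma gamma_integrand_ge0 x t : (0 <= (gamma_integrand x t)%:E)%E.
Proof. by rewrite lee_fin mulr_ge0 ?powR_ge0 ?expR_ge0. Qed.

Lemma is_derive_expRN t : is_derive t 1 (fun t : R => expR (- t)) (- expR (- t)).
Proof.
have dN : is_derive t 1 (fun t : R => - t) (- 1) by exact: is_deriveNid.
have := @is_derive1_comp _ expR (fun t : R => - t) t (expR (- t)) (- 1) _ dN.
by rewrite mulrN1; apply.
Qed.

Lemma gamma_by_parts a b x : 0 < x -> 0 < a -> a < b ->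
  (\int[mu]_(t in `[a, b]) (gamma_integrand (x + 1) t)%:E =
   (a `^ x * expR (- a) - b `^ x * expR (- b))%:E +
   x%:E * \int[mu]_(t in `[a, b]) (gamma_integrand x t)%:E)%E.
Proof.
move=> x0 a0 ab.
have pos t : a <= t <= b -> 0 < t by move=> /andP[+ _]; apply: lt_le_trans.
have dpow c t : a <= t <= b -> is_derive t 1 (@powR R ^~ c) (c * t `^ (c - 1)).
  by move=> /pos; exact: is_derive1_powR.
have dexp' t : a <= t <= b -> is_derive t 1 (fun t : R => expR (- t)) (- expR (- t)).
  by move=> _; exact: is_derive_expRN.
have dexp t : a <= t <= b -> is_derive t 1 (fun t : R => - expR (- t)) (expR (- t)).
  by move=> /dexp' d; rewrite -[X in is_derive _ _ _ X]opprK; exact: is_deriveN.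
have [F1 F2] := derivable_oo_LR ab (dpow x).
have [G1 G2] := derivable_oo_LR ab dexp.
have cf : {within `[a, b], continuous (fun t => x * t `^ (x - 1))}.
  apply: (@continuous_within _ (fun t => x *: ((x - 1) * t `^ (x - 1 - 1)))) => t tab.
  exact: (is_deriveZ x (dpow (x - 1) t tab)).
have := integration_by_parts ab cf F1 F2 (continuous_within dexp') G1 G2.
rewrite {1}/gamma_integrand addrK => ->; congr (_ + _)%E.
  by congr EFin; ring.
under eq_integral => t _ do rewrite mulrN -mulrA EFinN EFinM.
rewrite integral_ge0N /=; last first.
  move=> t _; apply: mule_ge0; last exact: (gamma_integrand_ge0 x t).
  by rewrite lee_fin ltW.
rewrite oppeK ge0_integralZl_EFin ?ltW //.
- by move=> t _; exact: gamma_integrand_ge0.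
- exact: measurable_gamma_integrand.
Qed.

(* An increasing sequence of segments that exhausts the half-line. *)
Let A (n : nat) : set R := `[n.+1%:R^-1, n.+2%:R].

Lemma cvg_gamma_integral x :
  (\int[mu]_(t in A n) (gamma_integrand x t)%:E)%E @[n --> \oo] -->
  gamma_integral x.
Proof.
have -> : gamma_integral x =
    (\int[mu]_(t in \bigcup_n A n) (gamma_integrand x t)%:E)%E.
  congr (integral _ _ _); apply/seteqP; split => t /=.
    rewrite in_itv /= andbT => t0.
    exists (Num.bound t + Num.bound t^-1)%N => //; rewrite /A /= in_itv /=.
    have ht : t < (Num.bound t)%:R by rewrite archi_boundP // ltW.
    have hi : t^-1 < (Num.bound t^-1)%:R by rewrite archi_boundP // invr_ge0 ltW.
    apply/andP; split; last first.
      by apply: le_trans (ltW ht) _; rewrite ler_nat -addn2 -addnA leq_addr.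
    rewrite -[leRHS]invrK lef_pV2 ?posrE ?invr_gt0 ?ltr0n //.
    by apply: le_trans (ltW hi) _; rewrite ler_nat addnC -addSn ltnW // ltn_addr.
  move=> [n _]; rewrite /A /= !in_itv /= andbT => /andP[+ _].
  by apply: lt_le_trans; rewrite invr_gt0.
apply: ge0_nondecreasing_set_cvg_integral.
- move=> n m nm; apply/subsetPset => t; rewrite /A /= !in_itv /= => /andP[h1 h2].
  apply/andP; split; first by apply: le_trans h1; rewrite lef_pV2 ?posrE ?ler_nat.
  by apply: le_trans h2 _; rewrite ler_nat.
- by move=> n; exact: measurable_itv.
- by move=> n; exact: measurable_gamma_integrand.
- by move=> n t _; exact: gamma_integrand_ge0.
Qed.

Lemma cvg_powR_expRN x : 0 < x ->
  (fun n => n.+2%:R `^ x * expR (- n.+2%:R)) @ \oo --> (0 : R).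
Proof.
move=> x0.
have [k kx] : exists k : nat, x <= k%:R.
  by exists (Num.bound x); rewrite ltW // archi_boundP // ltW.
have h n : 0 <= n.+2%:R `^ x * expR (- n.+2%:R) <= k.+1`!%:R * (harmonic n.+1 : R).
  rewrite mulr_ge0 ?powR_ge0 ?expR_ge0 //= expRN.
  rewrite ler_pdivrMr ?expR_gt0 //.
  apply: (@le_trans _ _ (n.+2%:R ^+ k)).
    by rewrite -powR_mulrn // ler_powR // ler1n.
  have := @expR_ge1Dxn R n.+2%:R k (ler0n _ _).
  have f0 : 0 < (k.+1)`!%:R :> R by rewrite ltr0n fact_gt0.
  move=> /(le_trans (_ : n.+2%:R ^+ k.+1 / (k.+1)`!%:R <= _)).
  rewrite lerDr ler01 => /(_ isT).
  rewrite ler_pdivrMr // exprS /harmonic /= => hh.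
  by rewrite mulrAC ler_pdivlMr ?ltr0n // mulrC (mulrC _ (expR _)).
apply: (@squeeze_cvgr _ _ _ _ (cst 0) (fun n => k.+1`!%:R * harmonic n.+1)).
- by apply: nearW => n; exact: h.
- exact: cvg_cst.
- rewrite -(mulr0 k.+1`!%:R); apply: cvgM; first exact: cvg_cst.
  by have := @cvg_harmonic R; rewrite -cvg_shiftS; apply.
Qed.

Lemma cvg_powR_inv x : 0 < x ->
  (fun n => n.+1%:R^-1 `^ x * expR (- n.+1%:R^-1)) @ \oo --> (0 : R).
Proof.
move=> x0; apply: (@squeeze_cvgr _ _ _ _ (cst 0) (fun n => n.+1%:R^-1 `^ x)).
- apply: nearW => n; rewrite mulr_ge0 ?powR_ge0 ?expR_ge0 //=.
  rewrite -[leRHS]mulr1 ler_wpM2l ?powR_ge0 //.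
- exact: cvg_cst.
- have /cvg_at_rightP := powR_cvg0 x0; apply; split; last exact: cvg_harmonic.
  by move=> n; rewrite invr_gt0.
Qed.

(** Integration by parts on an exhausting sequence of segments, which avoids
any discussion of the integrability of the integrand. *)
Lemma gamma_integral_rec x : 0 < x ->
  (gamma_integral (x + 1) = x%:E * gamma_integral x)%E.
Proof.
move=> x0.
have h1 := @cvg_gamma_integral (x + 1).
have h2 := @cvg_gamma_integral x.
suff h3 : (\int[mu]_(t in A n) (gamma_integrand (x + 1) t)%:E)%E @[n --> \oo]
    --> (x%:E * gamma_integral x)%E by exact: (cvg_unique _ h1 h3).
have -> : (fun n => \int[mu]_(t in A n) (gamma_integrand (x + 1) t)%:E)%E =
    (fun n => (n.+1%:R^-1 `^ x * expR (- n.+1%:R^-1) -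
               n.+2%:R `^ x * expR (- n.+2%:R))%:E +
      x%:E * \int[mu]_(t in A n) (gamma_integrand x t)%:E)%E.
  apply/funext => n; apply: gamma_by_parts => //.
  apply: (@le_lt_trans _ _ 1); last by rewrite ltr1n.
  by rewrite invf_le1 // ler1n.
rewrite -[X in _ --> X]add0e; apply: cvgeD.
- by rewrite fin_num_adde_defr.
- apply: cvg_EFin; first exact: nearW.
  rewrite -[0]subr0; apply: cvgB; [exact: cvg_powR_inv|exact: cvg_powR_expRN].
- exact: cvgeZl.
Qed.

Lemma gamma_integral1 : gamma_integral 1 = 1%E.
Proof.
have d t : is_derive t 1 (fun t : R => - expR (- t)) (expR (- t)).
  rewrite -[X in is_derive _ _ _ X]opprK.
  by apply: is_deriveN; exact: is_derive_expRN.
have c (f f' : R -> R) t : (forall t, is_derive t 1 f (f' t)) -> f @ t --> f t.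
  move=> /(_ t) [dft _]; apply: differentiable_continuous.
  exact/derivable1_diffP.
have -> : gamma_integral 1 = (\int[mu]_(t in `[0%R, +oo[) (expR (- t))%:E)%E.
  rewrite -integral_itv_obnd_cbnd; last first.
    apply: measurableT_comp => //; apply: measurable_funTS.
    by apply: measurableT_comp; [exact: measurable_expR | exact: oppr_measurable].
  apply: eq_integral => t _.
  by rewrite /gamma_integrand subrr powRr0 mul1r.
rewrite (@ge0_continuous_FTC2y _ _ (fun t => - expR (- t)) 0 0).
- by rewrite oppr0 expR0 -EFinB opprK add0r.
- by move=> t _; rewrite expR_ge0.
- apply: continuous_subspaceT => t.
  by apply: c => s; exact: is_derive_expRN.
- by rewrite -oppr0; apply: cvgN; exact: cvgr_expR.
- by move=> t _; case: (d t).
- by apply: cvg_at_right_filter; exact: c.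
- by move=> t _; rewrite derive1E; case: (d t).
Qed.

(** For [x] between 1 and 2 the integrand is at most [(1 + t) * exp (- t)], and it
is at least [exp (- 2)] for [t] between 1 and 2. *)
Lemma gamma_integral_12 x : 1 <= x <= 2 ->
  exists2 r : R, 0 < r & gamma_integral x = r%:E.
Proof.
move=> /andP[x1 x2].
have lb : ((expR (- 2))%:E <= gamma_integral x)%E.
  apply: (@le_trans _ _ (\int[mu]_(t in `[1%R, 2%R]) (gamma_integrand x t)%:E)%E).
    have -> : (expR (- 2))%:E = (\int[mu]_(t in `[1%R, 2%R]) (cst (expR (- 2))%:E t))%E.
      rewrite integral_cst //= lebesgue_measure_itv /= lte_fin ltr1n.
      by rewrite -EFinD -EFinM; congr EFin; ring.
    apply: ge0_le_integral => //=.
    - exact: measurable_gamma_integrand.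
    - move=> t; rewrite in_itv /= => /andP[t1 t2]; rewrite lee_fin.
      rewrite -[leLHS]mul1r ler_pM ?expR_ge0 ?ler_expR ?lerN2 //.
      by rewrite -[leLHS](powRr0 t) ler_powR // subr_ge0.
  apply: ge0_subset_integral => //.
  - exact: measurable_gamma_integrand.
  - by move=> t _; exact: gamma_integrand_ge0.
  - move=> t /=; rewrite !in_itv /= andbT => /andP[+ _].
    by apply: lt_le_trans.
have ub : (gamma_integral x <= 2%:E)%E.
  have -> : 2%:E = (gamma_integral 1 + gamma_integral 2)%E.
    rewrite (_ : gamma_integral 2 = 1%:E) ?gamma_integral1 //.
    by rewrite -[2]/(1 + 1) gamma_integral_rec // gamma_integral1 mule1.
  rewrite /gamma_integral -ge0_integralD //=.
  - apply: ge0_le_integral => //=.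
    + by move=> t _; exact: gamma_integrand_ge0.
    + exact: measurable_gamma_integrand.
    + by apply: emeasurable_funD; exact: measurable_gamma_integrand.
    + move=> t; rewrite in_itv /= andbT => t0; rewrite -EFinD lee_fin.
      rewrite -mulrDl ler_wpM2r ?expR_ge0 // subrr powRr0.
      have -> : t `^ (2 - 1) = t by rewrite -{2}[t]powRr1 ?ltW //; congr (_ `^ _); ring.
      have [t1|t1] := leP t 1.
        apply: (@le_trans _ _ 1); last by rewrite lerDl ltW.
        apply: (@le_trans _ _ (1 `^ (x - 1))); last by rewrite powR1.
        rewrite ge0_ler_powR ?nnegrE ?subr_ge0 //.
        exact: ltW.
      apply: (@le_trans _ _ (t `^ 1)); last by rewrite powRr1; lra.
      by apply: ler_powR; lra.
  - by move=> t _; exact: gamma_integrand_ge0.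
  - exact: measurable_gamma_integrand.
  - by move=> t _; exact: gamma_integrand_ge0.
  - exact: measurable_gamma_integrand.
case: (gamma_integral x) lb ub => [r| |] //; rewrite !lee_fin => lb _.
by exists r => //; apply: lt_le_trans lb; exact: expR_gt0.
Qed.

(** The recursion carries finiteness and positivity from that interval to
the whole half-line. *)
Lemma gamma_integral_pos x : 0 < x ->
  exists2 r : R, 0 < r & gamma_integral x = r%:E.
Proof.
have up n y : 1 <= y -> y <= n.+2%:R ->
    exists2 r : R, 0 < r & gamma_integral y = r%:E.
  elim: n y => [|n IH] y y1 yn; first by apply: gamma_integral_12; rewrite y1.
  have [y2|y2] := leP y 2; first by apply: gamma_integral_12; rewrite y1.
  have [||r r0 hr] := IH (y - 1); first by lra.
    by rewrite lerBlDr natr1.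
  exists ((y - 1) * r); first by rewrite mulr_gt0 //; lra.
  by rewrite -(subrK 1 y) gamma_integral_rec ?hr ?addrK //; lra.
move=> x0; have [r r0 hr] : exists2 r : R, 0 < r & gamma_integral (x + 1) = r%:E.
  apply: (up (Num.bound x)); first by lra.
  have := archi_boundP (ltW x0); rewrite -natr1 -natr1 => h.
  by apply: lerD => //; apply: le_trans (ltW h) _; rewrite lerDl.
move: hr; rewrite gamma_integral_rec //.
case: (gamma_integral x) => [s| |] //=.
- rewrite -EFinM => -[xs]; exists s => //.
  by rewrite -(pmulr_rgt0 _ x0) xs.
- by rewrite gt0_muley ?lte_fin.
- by rewrite gt0_muleNy ?lte_fin.
Qed.

Lemma Gamma_gt0 x : 0 < x -> 0 < Gamma x.
Proof.
move=> /gamma_integral_pos [r r0 hr].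
by rewrite [Gamma x]/(fine (gamma_integral x)) hr.
Qed.

Lemma GammaS x : 0 < x -> Gamma (x + 1) = x * Gamma x.
Proof.
move=> x0; rewrite [Gamma (x + 1)]/(fine (gamma_integral (x + 1))).
rewrite gamma_integral_rec // [Gamma x]/(fine (gamma_integral x)).
by have [r r0 ->] := gamma_integral_pos x0.
Qed.

End GammaFunction.

(** * Order relations in an interlacing configuration *)

Section Interlacing.
Variables (N M : nat).
Implicit Types (s : state N M) (i : 'I_N) (j : 'I_N.-1).

Lemma interlacingP s : reflect
  (forall i j, (i = j :> nat -> s.2 j <= s.1 i)%N /\
               (i = j.+1 :> nat -> s.1 i <= s.2 j)%N) (interlacing s).
Proof.
apply: (iffP forallP) => [h i j|h i].
  have /forallP/(_ j)/andP[/implyP h1 /implyP h2] := h i.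
  by split => /eqP; [exact: h1 | exact: h2].
apply/forallP => j; have [h1 h2] := h i j.
by apply/andP; split; apply/implyP => /eqP; [exact: h1 | exact: h2].
Qed.

Lemma lam_antimono s i i' : interlacing s -> (i <= i')%N -> (s.1 i' <= s.1 i)%N.
Proof.
move=> /interlacingP h; case: i' => n hn /=.
elim: n hn => [|n IH] hn.
  rewrite leqn0 => /eqP i0; rewrite (_ : Ordinal hn = i) //.
  exact: val_inj.
rewrite leq_eqVlt => /orP[/eqP e|]; first by rewrite (_ : Ordinal hn = i) //; exact: val_inj.
rewrite ltnS => /(IH (ltnW hn)); apply: leq_trans.
have hn' : (n < N.-1)%N by case: (N) hn.
have [_ /(_ erefl) h2] := h (Ordinal hn) (Ordinal hn').
have [/(_ erefl) h1 _] := h (Ordinal (ltnW hn)) (Ordinal hn').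
exact: leq_trans h2 h1.
Qed.

Lemma mu_le_lam s i j : interlacing s -> (i <= j)%N -> (s.2 j <= s.1 i)%N.
Proof.
move=> hs ij; have hj : (j < N)%N by apply: leq_trans (ltn_ord j) (leq_pred N).
apply: leq_trans (lam_antimono (i' := Ordinal hj) hs ij).
by have /interlacingP/(_ (Ordinal hj) j)[/(_ erefl)] := hs.
Qed.

Lemma lam_le_mu s i j : interlacing s -> (j < i)%N -> (s.1 i <= s.2 j)%N.
Proof.
move=> hs ij; have hj : (j.+1 < N)%N by case: (N) j {i ij} => [|n] [] //.
apply: leq_trans (lam_antimono (i := Ordinal hj) hs ij) _.
by have /interlacingP/(_ (Ordinal hj) j)[_ /(_ erefl)] := hs.
Qed.

Lemma mu_antimono s j j' : interlacing s -> (j <= j')%N -> (s.2 j' <= s.2 j)%N.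
Proof.
move=> hs; rewrite leq_eqVlt => /orP[/eqP/val_inj -> //|jj'].
have hj : (j' < N)%N by apply: leq_trans (ltn_ord j') (leq_pred N).
apply: leq_trans (mu_le_lam (i := Ordinal hj) hs (leqnn _)) _.
exact: lam_le_mu.
Qed.

End Interlacing.

Section Gaps.
Variables (R : realType) (N M : nat) (theta : R).
Hypothesis theta_gt0 : 0 < theta.
Implicit Types (s : state N M) (i : 'I_N) (j : 'I_N.-1).
Local Notation ell := (ell theta).
Local Notation emm := (emm theta).

(** The common shift of the rows: index [n] stands for [n.+1] in the one-based
convention, in both rows. *)
Definition row_shift (n : nat) : R := (N - n.+1)%N%:R * theta.

Lemma row_shift_lt n n' : (n < n')%N -> (n' < N)%N ->
  row_shift n' + theta <= row_shift n.
Proof.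
move=> nn' n'N; rewrite /row_shift -[X in _ + X]mul1r -mulrDl ler_pM2r //.
rewrite natr1 ler_nat; lia.
Qed.

Lemma ell_gap s i i' : interlacing s -> (i < i')%N ->
  ell s i' + theta <= ell s i.
Proof.
move=> hs ii'; have := row_shift_lt ii' (ltn_ord i').
have : (s.1 i')%:R <= (s.1 i)%:R :> R by rewrite ler_nat lam_antimono // ltnW.
by rewrite /Defs.ell /row_shift; lra.
Qed.

Lemma emm_gap s j j' : interlacing s -> (j < j')%N ->
  emm s j' + theta <= emm s j.
Proof.
move=> hs jj'; have hj : (j' < N)%N by apply: leq_trans (ltn_ord j') (leq_pred N).
have := row_shift_lt jj' hj.
have : (s.2 j')%:R <= (s.2 j)%:R :> R by rewrite ler_nat mu_antimono // ltnW.
by rewrite /Defs.emm /row_shift; lra.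
Qed.

Lemma emm_ell_gap s i j : interlacing s -> (j < i)%N ->
  ell s i + theta <= emm s j.
Proof.
move=> hs ji; have := row_shift_lt ji (ltn_ord i).
have : (s.1 i)%:R <= (s.2 j)%:R :> R by rewrite ler_nat lam_le_mu.
by rewrite /Defs.ell /Defs.emm /row_shift; lra.
Qed.

Lemma emm_le_ell s i j : interlacing s -> (i <= j)%N -> emm s j <= ell s i.
Proof.
move=> hs ij; have : (s.2 j)%:R <= (s.1 i)%:R :> R by rewrite ler_nat mu_le_lam.
have : row_shift j <= row_shift i.
  have hj : (j < N)%N by apply: leq_trans (ltn_ord j) (leq_pred N).
  move: ij; rewrite leq_eqVlt => /orP[/eqP->//|ij].
  by apply: le_trans (row_shift_lt ij hj); rewrite lerDl ltW.
by rewrite /Defs.ell /Defs.emm /row_shift; lra.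
Qed.

Lemma ell_ge0 s i : 0 <= ell s i.
Proof. by rewrite addr_ge0 // mulr_ge0 // ltW. Qed.

Lemma ell_le s i : ell s i <= M%:R + N.-1%:R * theta.
Proof.
apply: lerD; first by rewrite ler_nat -ltnS.
by rewrite ler_pM2r // ler_nat; lia.
Qed.

Lemma emm_ge s j : theta <= emm s j.
Proof.
rewrite -[leLHS]add0r; apply: lerD => //; rewrite -[leLHS]mul1r ler_pM2r //.
by rewrite ler1n subn_gt0; case: (N) j => [|n] [] //.
Qed.

Lemma emm_le s j : emm s j <= M%:R + N.-1%:R * theta.
Proof.
apply: lerD; first by rewrite ler_nat -ltnS.
by rewrite ler_pM2r // ler_nat; lia.
Qed.

End Gaps.

(** * Ratios of weights *)

Section BigopLemmas.

(** In a product over ordered pairs, the pairs that involve a given index [i0]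
are collected in a product over the other index. *)
Lemma prod_pairs_split (K : comPzRingType) n (F : 'I_n -> 'I_n -> K) (i0 : 'I_n) :
  \prod_(i < n) \prod_(j < n | (i < j)%N) F i j =
  (\prod_(k < n | k != i0) (if (i0 < k)%N then F i0 k else F k i0)) *
  \prod_(i < n | i != i0) \prod_(j < n | (i < j)%N && (j != i0)) F i j.
Proof.
rewrite (bigD1 i0) //= [X in X * _]big_mkcond /=.
rewrite (bigD1 i0) //= ltnn mul1r.
have -> : \prod_(i | i != i0) \prod_(j < n | (i < j)%N) F i j =
  (\prod_(i | i != i0) (if (i < i0)%N then F i i0 else 1)) *
  \prod_(i < n | i != i0) \prod_(j < n | (i < j)%N && (j != i0)) F i j.
  rewrite -big_split /=; apply: eq_bigr => i _.
  rewrite (bigID (fun j => j == i0)) /=; congr (_ * _).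
  case: ifP => h.
    by apply: big_pred1 => j /=; case: eqP => [->|]; rewrite ?h ?andbF.
  by apply: big_pred0 => j; case: eqP => [->|]; rewrite ?h ?andbF.
rewrite mulrA -big_split /=; congr (_ * _).
apply: eq_bigr => k ki; case: ltngtP => [_|_|/val_inj e]; rewrite ?mulr1 ?mul1r //.
by rewrite e eqxx in ki.
Qed.

Lemma prod_cross (K : comPzRingType) (I : finType) (P : pred I) (x x' c d : I -> K) :
  (forall i, P i -> x' i * c i = x i * d i) ->
  (\prod_(i | P i) x' i) * \prod_(i | P i) c i =
  (\prod_(i | P i) x i) * \prod_(i | P i) d i.
Proof. by move=> h; rewrite -!big_split; apply: eq_bigr. Qed.

End BigopLemmas.

Section ReducedWeight.
Variables (R : comPzRingType) (n p : nat) (theta : R) (g w tau : R -> R).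
Implicit Types (x : 'I_n -> R) (y : 'I_p -> R).

(** The interaction of [u], in the first row, with [v], in the second one; [b]
tells whether [u] is above [v]. *)
Definition cross_factor (b : bool) (u v : R) : R :=
  if b then g (u - v + theta) else g (v - u).

(** The weight of two finite sequences [x] and [y], with [g] in the role of a
ratio of Gamma functions; in an interlacing configuration [i <= j] means that
[x i] is above [y j]. *)
Definition reduced_weight x y : R :=
  (\prod_(i < n) \prod_(k < n | (i < k)%N) (x i - x k)) *
  (\prod_(j < p) \prod_(k < p | (j < k)%N) (y j - y k)) *
  (\prod_(i < n) w (x i)) * (\prod_(j < p) tau (y j)) *
  \prod_(i < n) \prod_(j < p) cross_factor (i <= j)%N (x i) (y j).

(** How the interaction must change when [u] is lowered by one. *)
Definition cross_shift (b : bool) (u v : R) : Prop :=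
  cross_factor b (u - 1) v * (u - v + theta - 1) =
  cross_factor b u v * (u - v).

Lemma reduced_weight_move_x x x' y i :
  x' i = x i - 1 -> (forall k, k != i -> x' k = x k) ->
  (forall j : 'I_p, cross_shift (i <= j)%N (x i) (y j)) ->
  (reduced_weight x' y * w (x i)) *
    ((\prod_(k < n | k != i) (x i - x k)) * \prod_(j < p) (x i - y j + theta - 1)) =
  (reduced_weight x y * w (x i - 1)) *
    ((\prod_(k < n | k != i) (x i - 1 - x k)) * \prod_(j < p) (x i - y j)).
Proof.
move=> ei ek hc.
have part : (\prod_(k < n | k != i) (if (i < k)%N then x' i - x' k else x' k - x' i)) *
      (\prod_(k < n | k != i) (x i - x k)) =
    (\prod_(k < n | k != i) (if (i < k)%N then x i - x k else x k - x i)) *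
      \prod_(k < n | k != i) (x i - 1 - x k).
  apply: prod_cross => k ki; rewrite ei ek //.
  by case: ifP => _; ring.
have cross : (\prod_(j < p) cross_factor (i <= j)%N (x' i) (y j)) *
      (\prod_(j < p) (x i - y j + theta - 1)) =
    (\prod_(j < p) cross_factor (i <= j)%N (x i) (y j)) * \prod_(j < p) (x i - y j).
  by apply: prod_cross => j _; rewrite ei; exact: hc.
rewrite /reduced_weight !(prod_pairs_split (fun l k : 'I_n => _ l - _ k) i).
rewrite (bigD1 i (F := fun l => w (x' l))) // (bigD1 i (F := fun l => w (x l))) //=.
rewrite (bigD1 i (F := fun l : 'I_n =>
  \prod_(j < p) cross_factor (l <= j)%N (x' l) (y j))) //=.
rewrite (bigD1 i (F := fun l : 'I_n =>
  \prod_(j < p) cross_factor (l <= j)%N (x l) (y j))) //=.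
move: part cross; rewrite ei.
have -> : \prod_(l < n | l != i) \prod_(k < n | (l < k)%N && (k != i)) (x' l - x' k) =
          \prod_(l < n | l != i) \prod_(k < n | (l < k)%N && (k != i)) (x l - x k).
  by apply: eq_bigr => l li; apply: eq_bigr => k /andP[_ ki]; rewrite !ek.
have -> : \prod_(l < n | l != i) w (x' l) = \prod_(l < n | l != i) w (x l).
  by apply: eq_bigr => l li; rewrite ek.
have -> : \prod_(l < n | l != i) \prod_(j < p) cross_factor (l <= j)%N (x' l) (y j) =
          \prod_(l < n | l != i) \prod_(j < p) cross_factor (l <= j)%N (x l) (y j).
  by apply: eq_bigr => l li; apply: eq_bigr => j _; rewrite ek.
have ac (a a' b b' u v c d e f r1 r2 r3 r4 r5 : R) : a' * c = a * e -> b' * d = b * f ->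
  (a' * r1 * r2 * (v * r3) * r4 * (b' * r5)) * u * (c * d) =
  (a * r1 * r2 * (u * r3) * r4 * (b * r5)) * v * (e * f).
  move=> h1 h2; transitivity (r1 * r2 * r3 * r4 * r5 * u * v * (a' * c) * (b' * d)).
    by ring.
  by rewrite h1 h2; ring.
by move=> h1 h2; exact: ac.
Qed.

(** The interaction is symmetric up to a shift by [theta] and an exchange of the
two cases, which is how [cross_shift] applies to the second row. *)
Lemma reduced_weight_move_y x y y' j :
  y' j = y j - 1 -> (forall k, k != j -> y' k = y k) ->
  (forall i : 'I_n, cross_shift (~~ (i <= j)%N) (y j) (x i + theta)) ->
  (reduced_weight x y' * tau (y j)) *
    ((\prod_(k < p | k != j) (y j - y k)) * \prod_(i < n) (y j - 1 - x i)) =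
  (reduced_weight x y * tau (y j - 1)) *
    ((\prod_(k < p | k != j) (y j - 1 - y k)) * \prod_(i < n) (y j - x i - theta)).
Proof.
move=> ej ek hc.
have part : (\prod_(k < p | k != j) (if (j < k)%N then y' j - y' k else y' k - y' j)) *
      (\prod_(k < p | k != j) (y j - y k)) =
    (\prod_(k < p | k != j) (if (j < k)%N then y j - y k else y k - y j)) *
      \prod_(k < p | k != j) (y j - 1 - y k).
  apply: prod_cross => k kj; rewrite ej ek //.
  by case: ifP => _; ring.
have cross : (\prod_(i < n) cross_factor (i <= j)%N (x i) (y' j)) *
      (\prod_(i < n) (y j - 1 - x i)) =
    (\prod_(i < n) cross_factor (i <= j)%N (x i) (y j)) * \prod_(i < n) (y j - x i - theta).
  apply: prod_cross => i _; rewrite ej; have := hc i.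
  have -> : y j - x i - theta = y j - (x i + theta) by ring.
  rewrite /cross_shift /cross_factor; case: (i <= j)%N => /=.
    rewrite (_ : x i + theta - (y j - 1) = x i - (y j - 1) + theta); last ring.
    rewrite (_ : x i + theta - y j = x i - y j + theta); last ring.
    rewrite (_ : y j - (x i + theta) + theta - 1 = y j - 1 - x i); last ring.
    exact.
  rewrite (_ : y j - 1 - (x i + theta) + theta = y j - 1 - x i); last ring.
  rewrite (_ : y j - (x i + theta) + theta = y j - x i); last ring.
  rewrite (_ : y j - x i - 1 = y j - 1 - x i); last ring.
  exact.
rewrite /reduced_weight !(prod_pairs_split (fun l k : 'I_p => _ l - _ k) j).
rewrite (bigD1 j (F := fun l => tau (y' l))) // (bigD1 j (F := fun l => tau (y l))) //=.
rewrite (exchange_big_dep xpredT (F := fun (i : 'I_n) (l : 'I_p) =>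
  cross_factor (i <= l)%N (x i) (y' l))) //=.
rewrite (exchange_big_dep xpredT (F := fun (i : 'I_n) (l : 'I_p) =>
  cross_factor (i <= l)%N (x i) (y l))) //=.
rewrite (bigD1 j (F := fun l : 'I_p =>
  \prod_(i < n) cross_factor (i <= l)%N (x i) (y' l))) //=.
rewrite (bigD1 j (F := fun l : 'I_p =>
  \prod_(i < n) cross_factor (i <= l)%N (x i) (y l))) //=.
move: part cross; rewrite ej.
have -> : \prod_(l < p | l != j) \prod_(k < p | (l < k)%N && (k != j)) (y' l - y' k) =
          \prod_(l < p | l != j) \prod_(k < p | (l < k)%N && (k != j)) (y l - y k).
  by apply: eq_bigr => l lj; apply: eq_bigr => k /andP[_ kj]; rewrite !ek.
have -> : \prod_(l < p | l != j) tau (y' l) = \prod_(l < p | l != j) tau (y l).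
  by apply: eq_bigr => l lj; rewrite ek.
have -> : \prod_(l < p | l != j) \prod_(i < n) cross_factor (i <= l)%N (x i) (y' l) =
          \prod_(l < p | l != j) \prod_(i < n) cross_factor (i <= l)%N (x i) (y l).
  by apply: eq_bigr => l lj; apply: eq_bigr => i _; rewrite ek.
have ac (a a' b b' u v c d e f r1 r2 r3 r4 r5 : R) : a' * c = a * e -> b' * d = b * f ->
  (r1 * (a' * r2) * r3 * (v * r4) * (b' * r5)) * u * (c * d) =
  (r1 * (a * r2) * r3 * (u * r4) * (b * r5)) * v * (e * f).
  move=> h1 h2; transitivity (r1 * r2 * r3 * r4 * r5 * u * v * (a' * c) * (b' * d)).
    by ring.
  by rewrite h1 h2; ring.
by move=> h1 h2; exact: ac.
Qed.

End ReducedWeight.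

(** The functional equation of [g] gives the two cases of [cross_shift]. *)
Section CrossShift.
Variables (R : realFieldType) (theta : R) (g : R -> R).
Hypothesis gS : forall x, 0 < x -> 0 < x + 1 - theta ->
  g (x + 1) * (x + 1 - theta) = g x * x.

Lemma cross_shift_above (u v : R) : 0 < u - v -> 0 < u - 1 - v + theta ->
  cross_shift theta g true u v.
Proof.
move=> uv0 uv1; rewrite /cross_shift /cross_factor.
have uv2 : 0 < u - 1 - v + theta + 1 - theta by lra.
have := gS uv1 uv2.
rewrite (_ : u - 1 - v + theta + 1 = u - v + theta); last ring.
rewrite (_ : u - v + theta - theta = u - v); last ring.
rewrite (_ : u - v + theta - 1 = u - 1 - v + theta); last ring.
by move=> <-.
Qed.

Lemma cross_shift_below (u v : R) : 0 < v - u -> 0 < v - u + 1 - theta ->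
  cross_shift theta g false u v.
Proof.
move=> uv0 uv1; rewrite /cross_shift /cross_factor.
rewrite (_ : v - (u - 1) = v - u + 1); last ring.
rewrite (_ : u - v + theta - 1 = - (v - u + 1 - theta)); last ring.
by rewrite mulrN (gS uv0 uv1) -mulrN opprB.
Qed.

End CrossShift.

Section WeightRatios.
Variables (R : realType) (N M : nat) (theta : R) (w tau : R -> R).
Hypothesis theta_gt0 : 0 < theta.
Implicit Types (s : state N M) (i k : 'I_N) (j : 'I_N.-1).
Local Notation ell := (ell theta).
Local Notation emm := (emm theta).

(** The ratio of Gamma functions that all the interactions between the two rows
reduce to. *)
Definition gamma_ratio (x : R) : R := Gamma x / Gamma (x - theta + 1).

Lemma gamma_ratioS x : 0 < x -> 0 < x + 1 - theta ->
  gamma_ratio (x + 1) * (x + 1 - theta) = gamma_ratio x * x.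
Proof.
move=> x0 y0; rewrite /gamma_ratio (GammaS x0) (GammaS y0).
rewrite (_ : x - theta + 1 = x + 1 - theta); last ring.
have := Gamma_gt0 y0; move: (Gamma x) (Gamma _) => p q q0.
by field; rewrite !gt_eqF.
Qed.

(** In the product of the three factors of the weight most Gamma functions
cancel, and both rows are left with a Vandermonde product. *)
Lemma weightE s : interlacing s -> 
  weight theta w tau s =
  reduced_weight theta gamma_ratio w tau (ell s) (emm s).
Proof.
have th := theta_gt0; move=> hs; rewrite /weight /Htop /Hbot /Iint /reduced_weight.
have -> : \prod_(i < N) \prod_(k < N | (i < k)%N) (ell s i - ell s k) =
  (\prod_(i < N) \prod_(k < N | (i < k)%N)
     (Gamma (ell s i - ell s k + 1) / Gamma (ell s i - ell s k - theta + 1))) *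
  (\prod_(i < N) \prod_(k < N | (i < k)%N)
     (Gamma (ell s i - ell s k - theta + 1) / Gamma (ell s i - ell s k))).
  rewrite -big_split; apply: eq_bigr => i _ /=.
  rewrite -big_split; apply: eq_bigr => k ik /=.
  have := ell_gap theta_gt0 hs ik => gap.
  have d0 : 0 < ell s i - ell s k by lra.
  have e0 : 0 < ell s i - ell s k - theta + 1 by lra.
  rewrite GammaS //; have := Gamma_gt0 d0; have := Gamma_gt0 e0.
  move: (Gamma (ell s i - ell s k)) (Gamma (_ - theta + 1)) => p q q0 p0.
  by field; rewrite !gt_eqF.
have -> : \prod_(i < N.-1) \prod_(k < N.-1 | (i < k)%N) (emm s i - emm s k) =
  (\prod_(i < N.-1) \prod_(k < N.-1 | (i < k)%N)
     (Gamma (emm s i - emm s k + theta) / Gamma (emm s i - emm s k))) *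
  (\prod_(i < N.-1) \prod_(k < N.-1 | (i < k)%N)
     (Gamma (emm s i - emm s k + 1) / Gamma (emm s i - emm s k + theta))).
  rewrite -big_split; apply: eq_bigr => i _ /=.
  rewrite -big_split; apply: eq_bigr => k ik /=.
  have := emm_gap theta_gt0 hs ik => gap.
  have d0 : 0 < emm s i - emm s k by lra.
  have e0 : 0 < emm s i - emm s k + theta by lra.
  rewrite GammaS //; have := Gamma_gt0 d0; have := Gamma_gt0 e0.
  move: (Gamma (emm s i - emm s k)) (Gamma (_ + theta)) => p q q0 p0.
  by field; rewrite !gt_eqF.
have -> : \prod_(i < N) \prod_(j < N.-1)
    cross_factor theta gamma_ratio (i <= j)%N (ell s i) (emm s j) =
  (\prod_(i < N.-1) \prod_(j < N | (i < j)%N)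
     (Gamma (emm s i - ell s j) / Gamma (emm s i - ell s j - theta + 1))) *
  (\prod_(i < N) \prod_(j < N.-1 | (i <= j)%N)
     (Gamma (ell s i - emm s j + theta) / Gamma (ell s i - emm s j + 1))).
  rewrite [X in _ = X * _](exchange_big_dep predT) //= -big_split /=.
  apply: eq_bigr => i _.
  rewrite (bigID (fun j : 'I_N.-1 => (i <= j)%N)) /= mulrC; congr (_ * _).
    by apply: eq_big => [j|j /negPf]; rewrite ?ltnNge // /cross_factor => ->.
  apply: eq_bigr => j ij; rewrite /cross_factor ij /gamma_ratio.
  by congr (_ / Gamma _); ring.
have regroup (a b c d e f g h : R) :
  (a * b) * (c * d) * (e * f * g * h) = (a * e) * (c * f) * b * d * (g * h).
  by ring.
exact: regroup.
Qed.

Hypothesis w_gt0 : forall x : R, 0 <= x <= M%:R + N.-1%:R * theta -> 0 < w x.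
Hypothesis tau_gt0 :
  forall x : R, theta <= x <= M%:R + N.-1%:R * theta -> 0 < tau x.

Lemma gamma_ratio_gt0 x : theta <= x -> 0 < gamma_ratio x.
Proof. by have th := theta_gt0; move=> hx; rewrite divr_gt0 // Gamma_gt0 //; lra. Qed.

Lemma weight_gt0 s : interlacing s -> 0 < weight theta w tau s.
Proof.
have th := theta_gt0; move=> hs; rewrite weightE // /reduced_weight !mulr_gt0 //.
- apply: prodr_gt0 => i _; apply: prodr_gt0 => k ik.
  by have := ell_gap theta_gt0 hs ik; lra.
- apply: prodr_gt0 => i _; apply: prodr_gt0 => k ik.
  by have := emm_gap theta_gt0 hs ik; lra.
- by apply: prodr_gt0 => i _; rewrite w_gt0 // ell_ge0 // ell_le.
- by apply: prodr_gt0 => j _; rewrite tau_gt0 // emm_ge // emm_le.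
- apply: prodr_gt0 => i _; apply: prodr_gt0 => j _; rewrite /cross_factor.
  case: leqP => ij; apply: gamma_ratio_gt0.
    by have := emm_le_ell theta_gt0 hs ij; lra.
  by have := emm_ell_gap theta_gt0 hs ij; lra.
Qed.

End WeightRatios.

(** [s'] is obtained from [s] by lowering by one the [i]-th upper, respectively
the [j]-th lower, particle. *)
Definition lowers_ell N M (s s' : state N M) (i : 'I_N) : Prop :=
  [/\ s'.2 = s.2, (s'.1 i).+1 = s.1 i :> nat &
      forall k, k != i -> s'.1 k = s.1 k].

Definition lowers_emm N M (s s' : state N M) (j : 'I_N.-1) : Prop :=
  [/\ s'.1 = s.1, (s'.2 j).+1 = s.2 j :> nat &
      forall k, k != j -> s'.2 k = s.2 k].

Section Lowering.
Variables (R : realType) (N M : nat) (theta : R).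
Implicit Types s : state N M.

Lemma lowers_ellE s s' i : lowers_ell s s' i ->
  [/\ ell theta s' i = ell theta s i - 1,
      forall k, k != i -> ell theta s' k = ell theta s k &
      forall j, emm theta s' j = emm theta s j].
Proof.
move=> [e2 ei ek]; split.
- by rewrite /ell -ei -natr1; ring.
- by move=> k /ek e; rewrite /ell e.
- by move=> j; rewrite /emm e2.
Qed.

Lemma lowers_emmE s s' j : lowers_emm s s' j ->
  [/\ emm theta s' j = emm theta s j - 1,
      forall k, k != j -> emm theta s' k = emm theta s k &
      forall i, ell theta s' i = ell theta s i].
Proof.
move=> [e1 ej ek]; split.
- by rewrite /emm -ej -natr1; ring.
- by move=> k /ek e; rewrite /emm e.
- by move=> i; rewrite /ell e1.
Qed.

End Lowering.

(** How a weight [W] changes when one particle moves, if [w] and [tau] are the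
weights of single particles. *)
Record admissible (R : realType) (N M : nat) (theta : R) (w tau : R -> R)
    (W : state N M -> R) : Prop := Admissible {
  adm_ell : forall s s' i, interlacing s -> interlacing s' ->
    lowers_ell s s' i -> let a := ell theta s i in
    (W s' * w a) * ((\prod_(k < N | k != i) (a - ell theta s k)) *
      \prod_j (a - emm theta s j + theta - 1)) =
    (W s * w (a - 1)) * ((\prod_(k < N | k != i) (a - 1 - ell theta s k)) *
      \prod_j (a - emm theta s j));
  adm_emm : forall s s' j, interlacing s -> interlacing s' ->
    lowers_emm s s' j -> let a := emm theta s j in
    (W s' * tau a) * ((\prod_(k < N.-1 | k != j) (a - emm theta s k)) *
      \prod_i (a - 1 - ell theta s i)) =
    (W s * tau (a - 1)) * ((\prod_(k < N.-1 | k != j) (a - 1 - emm theta s k)) *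
      \prod_i (a - ell theta s i - theta)) }.

Section Admissibility.
Variables (R : realType) (N M : nat) (theta : R) (w tau : R -> R).
Hypothesis theta_gt0 : 0 < theta.
Implicit Types (s : state N M) (i k : 'I_N) (j : 'I_N.-1).
Local Notation ell := (ell theta).
Local Notation emm := (emm theta).

Lemma weight_lowers_ell s s' i : interlacing s -> interlacing s' ->
  lowers_ell s s' i -> let a := ell s i in
  (weight theta w tau s' * w a) * ((\prod_(k < N | k != i) (a - ell s k)) *
    \prod_j (a - emm s j + theta - 1)) =
  (weight theta w tau s * w (a - 1)) * ((\prod_(k < N | k != i) (a - 1 - ell s k)) *
    \prod_j (a - emm s j)).
Proof.
have th := theta_gt0; move=> hs hs' low a; have [ei' ek em'] := lowers_ellE theta low.
have em : emm s' = emm s by apply/funext.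
rewrite !weightE // em; apply: reduced_weight_move_x => //.
move=> j; case: leqP => ij.
  have := emm_le_ell theta_gt0 hs' ij; rewrite ei' em /a => h.
  by apply: (cross_shift_above (@gamma_ratioS _ theta)); lra.
have := emm_ell_gap theta_gt0 hs ij => h.
by apply: (cross_shift_below (@gamma_ratioS _ theta)); lra.
Qed.

Lemma weight_lowers_emm s s' j : interlacing s -> interlacing s' ->
  lowers_emm s s' j -> let a := emm s j in
  (weight theta w tau s' * tau a) * ((\prod_(k < N.-1 | k != j) (a - emm s k)) *
    \prod_i (a - 1 - ell s i)) =
  (weight theta w tau s * tau (a - 1)) *
    ((\prod_(k < N.-1 | k != j) (a - 1 - emm s k)) *
    \prod_i (a - ell s i - theta)).
Proof.
have th := theta_gt0; move=> hs hs' low a; have [ej' ek el'] := lowers_emmE theta low.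
have el : ell s' = ell s by apply/funext.
rewrite !weightE // el; apply: reduced_weight_move_y => //.
move=> i; case: leqP => ij /=.
  have := emm_le_ell theta_gt0 hs ij => h.
  by apply: (cross_shift_below (@gamma_ratioS _ theta)); lra.
have := emm_ell_gap theta_gt0 hs' ij; rewrite ej' el /a => h.
by apply: (cross_shift_above (@gamma_ratioS _ theta)); lra.
Qed.

Lemma weight_admissible : admissible theta w tau (@weight R N M theta w tau).
Proof. by split; [exact: weight_lowers_ell | exact: weight_lowers_emm]. Qed.

End Admissibility.

(** * Residues and the local cancellations *)

Section CancellationAlgebra.
Variable K : fieldType.
Implicit Types (x y z c t p : K).

Lemma cancel_top_mid_algebra x y y1 z z1 c t p v v1 u u' : c * (1 - t) = t ->
  v != 0 -> y != 0 -> y1 != 0 -> z1 != 0 ->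
  u' * v * (y * z) = u * v1 * (y1 * z1) ->
  p * (v1 / v) * (u * (- t * (x / y))) +
  c * p * (u' * ((1 - t) * (x / y1 * (z / z1)))) = 0.
Proof.
move=> ct v0 y0 y10 z10 rel.
have -> : c * p * (u' * ((1 - t) * (x / y1 * (z / z1)))) =
  c * (1 - t) * p * x * (u' * v * (y * z)) / (v * y * y1 * z1).
  by field; rewrite v0 y0 y10 z10.
rewrite ct rel; field.
by rewrite v0 y0 y10 z10.
Qed.

Lemma cancel_mid_bot_algebra x y y1 z z1 c t p v v1 u u' : c * (1 - t) = t ->
  v1 != 0 -> y != 0 -> y1 != 0 -> z != 0 ->
  u' * v * (y * z) = u * v1 * (y1 * z1) ->
  c * p * (u * ((t - 1) * (z1 / z * (x / y)))) +
  p * (v / v1) * (u' * (t * (x / y1))) = 0.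
Proof.
move=> ct v0 y0 y10 z10 rel.
have -> : p * (v / v1) * (u' * (t * (x / y1))) =
  t * p * x * (u' * v * (y * z)) / (v1 * y * y1 * z).
  by field; rewrite v0 y0 y10 z10.
rewrite rel -[X in _ + X * _ * _ * _ / _]ct; field.
by rewrite v0 y0 y10 z10.
Qed.

End CancellationAlgebra.

Section Residues.
Variables (R : realType) (K : fieldType) (iota : {rmorphism R -> K}).
Variables (N M : nat) (theta : R).
Hypothesis theta_gt0 : 0 < theta.
Implicit Types (s : state N M) (i : 'I_N) (j : 'I_N.-1).
Local Notation S := (M%:R + N.-1%:R * theta).
Local Notation t := (iota theta).
Local Notation L s i := (iota (ell theta s i)).
Local Notation E s j := (iota (emm theta s j)).

(** The residues of the three products of the observable: [res_top] at
[z = ell i], [res_bot] at [z = emm j + 1], [res_mid_ell] at [z = ell i + 1] and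
[res_mid_emm] at [z = emm j]. *)
Definition res_top s i : K :=
  - t * \prod_(k < N | k != i) ((L s i - L s k - t) / (L s i - L s k)).

Definition res_bot s j : K :=
  t * \prod_(k < N.-1 | k != j) ((E s j - E s k + t) / (E s j - E s k)).

Definition res_mid_ell s i : K :=
  (1 - t) *
  (\prod_(k < N | k != i) ((L s i + 1 - L s k - t) / (L s i - L s k)) *
   \prod_(j < N.-1) ((L s i - E s j + t) / (L s i + 1 - E s j))).

Definition res_mid_emm s j : K :=
  (t - 1) *
  (\prod_(i < N) ((E s j - L s i - t) / (E s j - L s i - 1)) *
   \prod_(k < N.-1 | k != j) ((E s j - E s k - 1 + t) / (E s j - E s k))).

Lemma iota_neq0 (x y : R) : x != y -> iota x - iota y != 0.
Proof. by move=> xy; rewrite -rmorphB fmorph_eq0 subr_eq0. Qed.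

Lemma ell_neq s i k : interlacing s -> k != i -> ell theta s i != ell theta s k.
Proof.
have th := theta_gt0; move=> hs; rewrite neq_ltn => /orP[] h.
  by have := ell_gap theta_gt0 hs h; apply: contraTneq => ->; rewrite -ltNge; lra.
by have := ell_gap theta_gt0 hs h; apply: contraTneq => ->; rewrite -ltNge; lra.
Qed.

Lemma emm_neq s j k : interlacing s -> k != j -> emm theta s j != emm theta s k.
Proof.
have th := theta_gt0; move=> hs; rewrite neq_ltn => /orP[] h.
  by have := emm_gap theta_gt0 hs h; apply: contraTneq => ->; rewrite -ltNge; lra.
by have := emm_gap theta_gt0 hs h; apply: contraTneq => ->; rewrite -ltNge; lra.
Qed.

Variables (w tau : R -> R) (W : state N M -> R) (phit phib phim : K -> K).
Hypothesis hadm : admissible theta w tau W.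
Hypothesis W_neq0 : forall s, interlacing s -> W s != 0.
Hypothesis w_gt0 : forall x : R, 0 <= x <= S -> 0 < w x.
Hypothesis tau_gt0 : forall x : R, theta <= x <= S -> 0 < tau x.
Hypothesis theta_neq1 : theta != 1.
Hypothesis ratio_top : forall z : R, 1 <= z <= S ->
  phit (iota z) / phim (iota z) = iota (w (z - 1) / w z).
Hypothesis ratio_bot : forall z : R, theta + 1 <= z <= S ->
  phib (iota z) / phim (iota z) = iota (tau z / tau (z - 1)).

Local Notation c := (iota (theta / (1 - theta))).

Lemma coefK : c * (1 - t) = t.
Proof.
rewrite -(rmorph1 iota) -rmorphB -rmorphM divfK // subr_eq0 eq_sym.
exact: theta_neq1.
Qed.

(** The residue of the first product at [a = ell i] cancels that of the third
product at the same point for the configuration with [ell i = a - 1]. *)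
Lemma cancel_top_mid s s' i : interlacing s -> interlacing s' ->
  lowers_ell s s' i -> let a := L s i in
  phit a * (iota (W s) * res_top s i) +
  c * phim a * (iota (W s') * res_mid_ell s' i) = 0.
Proof.
move=> hs hs' low a; have [ei ek em] := lowers_ellE theta low.
have rel := congr1 iota (adm_ell hadm hs hs' low).
have th := theta_gt0.
have x1 : 1 <= ell theta s i.
  by have := ell_ge0 theta_gt0 s' i; rewrite ei; lra.
have xS := ell_le theta_gt0 s i.
have w0 : w (ell theta s i) != 0 by rewrite gt_eqF // w_gt0 // xS andbT; lra.
have w1 : w (ell theta s i - 1) != 0.
  by rewrite gt_eqF // w_gt0 //; apply/andP; split; lra.
have := ratio_top (_ : 1 <= ell theta s i <= S); rewrite x1 xS => /(_ isT).
rewrite fmorph_div -/a => rt.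
have m0 : phim a != 0.
  apply: contraNneq w1 => p0; rewrite -(fmorph_eq0 iota).
  move: rt; rewrite p0 invr0 mulr0 => /esym/eqP.
  by rewrite mulf_eq0 invr_eq0 !fmorph_eq0 (negPf w0) orbF.
have phitE : phit a = phim a * (iota (w (ell theta s i - 1)) / iota (w (ell theta s i))).
  by rewrite -rt mulrC divfK.
rewrite phitE /res_top /res_mid_ell ei.
have -> : \prod_(k < N | k != i) ((iota (ell theta s i - 1) + 1 - L s' k - t) /
     (iota (ell theta s i - 1) - L s' k)) =
   \prod_(k < N | k != i) ((a - L s k - t) / (a - 1 - L s k)).
  by apply: eq_bigr => k ki; rewrite ek // rmorphB rmorph1 subrK.
have -> : \prod_(j < N.-1) ((iota (ell theta s i - 1) - E s' j + t) /
     (iota (ell theta s i - 1) + 1 - E s' j)) =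
   \prod_(j < N.-1) ((a - E s j + t - 1) / (a - E s j)).
  apply: eq_bigr => j _; rewrite em // rmorphB rmorph1 subrK.
  by congr (_ / _); rewrite -/a; ring.
have [y0 y10 z10] : [/\ \prod_(k < N | k != i) (a - L s k) != 0,
    \prod_(k < N | k != i) (a - 1 - L s k) != 0 &
    \prod_(j < N.-1) (a - E s j) != 0].
  split.
  - by apply/prodf_neq0 => k ki; apply: iota_neq0; exact: ell_neq.
  - apply/prodf_neq0 => k ki; rewrite -ek // /a -(rmorph1 iota) -rmorphB -ei.
    by apply: iota_neq0; exact: ell_neq.
  - apply/prodf_neq0 => j _; apply: iota_neq0.
    have [ij|ij] := leqP i j.
      by have := emm_le_ell theta_gt0 hs' ij; rewrite ei em => h; apply/eqP; lra.
    by have := emm_ell_gap theta_gt0 hs ij => h; apply/eqP; lra.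
move: coefK rel; move: (iota (theta / (1 - theta))) => c0 cK.
rewrite !rmorphM !rmorph_prod.
have -> : \prod_(k < N | k != i) iota (ell theta s i - ell theta s k) =
          \prod_(k < N | k != i) (a - L s k).
  by apply: eq_bigr => k _; rewrite rmorphB.
have -> : \prod_(k < N | k != i) iota (ell theta s i - 1 - ell theta s k) =
          \prod_(k < N | k != i) (a - 1 - L s k).
  by apply: eq_bigr => k _; rewrite !rmorphB rmorph1.
have -> : \prod_(j < N.-1) iota (ell theta s i - emm theta s j + theta - 1) =
          \prod_(j < N.-1) (a - E s j + t - 1).
  by apply: eq_bigr => k _; rewrite rmorphB rmorph1 rmorphD rmorphB.
have -> : \prod_(j < N.-1) iota (ell theta s i - emm theta s j) =
          \prod_(j < N.-1) (a - E s j).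
  by apply: eq_bigr => k _; rewrite rmorphB.
rewrite !big_split /= !prodfV.
have iw0 : iota (w (ell theta s i)) != 0 by rewrite fmorph_eq0.
exact: (cancel_top_mid_algebra _ _ cK).
Qed.

Lemma cancel_mid_bot s s' j : interlacing s -> interlacing s' ->
  lowers_emm s s' j -> let a := E s j in
  c * phim a * (iota (W s) * res_mid_emm s j) +
  phib a * (iota (W s') * res_bot s' j) = 0.
Proof.
move=> hs hs' low a; have [ej ek el] := lowers_emmE theta low.
have rel := congr1 iota (adm_emm hadm hs hs' low).
have th := theta_gt0.
have x1 : theta + 1 <= emm theta s j.
  by have := emm_ge theta_gt0 s' j; rewrite ej; lra.
have xS := emm_le theta_gt0 s j.
have w0 : tau (emm theta s j) != 0.
  by rewrite gt_eqF // tau_gt0 // xS andbT; lra.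
have w1 : tau (emm theta s j - 1) != 0.
  by rewrite gt_eqF // tau_gt0 //; apply/andP; split; lra.
have := ratio_bot (_ : theta + 1 <= emm theta s j <= S); rewrite x1 xS => /(_ isT).
rewrite fmorph_div -/a => rt.
have m0 : phim a != 0.
  apply: contraNneq w1 => p0; rewrite -(fmorph_eq0 iota).
  move: rt; rewrite p0 invr0 mulr0 => /esym/eqP.
  by rewrite mulf_eq0 invr_eq0 !fmorph_eq0 (negPf w0).
have phibE : phib a =
    phim a * (iota (tau (emm theta s j)) / iota (tau (emm theta s j - 1))).
  by rewrite -rt mulrC divfK.
rewrite phibE /res_bot /res_mid_emm ej.
have -> : \prod_(k < N.-1 | k != j) ((iota (emm theta s j - 1) - E s' k + t) /
     (iota (emm theta s j - 1) - E s' k)) =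
   \prod_(k < N.-1 | k != j) ((a - E s k - 1 + t) / (a - 1 - E s k)).
  apply: eq_bigr => k kj; rewrite ek // rmorphB rmorph1 -/a.
  by congr (_ / _); ring.
rewrite -/a.
have [y0 y10 z0] : [/\ \prod_(k < N.-1 | k != j) (a - E s k) != 0,
    \prod_(k < N.-1 | k != j) (a - 1 - E s k) != 0 &
    \prod_(i < N) (a - L s i - 1) != 0].
  split.
  - by apply/prodf_neq0 => k kj; apply: iota_neq0; exact: emm_neq.
  - apply/prodf_neq0 => k kj; rewrite -ek // /a -(rmorph1 iota) -rmorphB -ej.
    by apply: iota_neq0; exact: emm_neq.
  - apply/prodf_neq0 => i _; rewrite addrAC /a -(rmorph1 iota) -rmorphB.
    apply: iota_neq0; have [ij|ij] := leqP i j.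
      by have := emm_le_ell theta_gt0 hs ij => h; apply/eqP; lra.
    by have := emm_ell_gap theta_gt0 hs' ij; rewrite ej el => h; apply/eqP; lra.
move: coefK rel; move: (iota (theta / (1 - theta))) => c0 cK.
rewrite !rmorphM !rmorph_prod.
have -> : \prod_(k < N.-1 | k != j) iota (emm theta s j - emm theta s k) =
          \prod_(k < N.-1 | k != j) (a - E s k).
  by apply: eq_bigr => k _; rewrite rmorphB.
have -> : \prod_(k < N.-1 | k != j) iota (emm theta s j - 1 - emm theta s k) =
          \prod_(k < N.-1 | k != j) (a - 1 - E s k).
  by apply: eq_bigr => k _; rewrite !rmorphB rmorph1.
have -> : \prod_(i < N) iota (emm theta s j - 1 - ell theta s i) =
          \prod_(i < N) (a - L s i - 1).
  by apply: eq_bigr => k _; rewrite !rmorphB rmorph1 addrAC.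
have -> : \prod_(i < N) iota (emm theta s j - ell theta s i - theta) =
          \prod_(i < N) (a - L s i - t).
  by apply: eq_bigr => k _; rewrite !rmorphB.
rewrite !big_split /= !prodfV.
have iw1 : iota (tau (emm theta s j - 1)) != 0 by rewrite fmorph_eq0.
exact: (cancel_mid_bot_algebra _ _ cK).
Qed.

(** When [ell i] and [emm j] meet at [a], with [i = j], the remaining residues of
the first product at [s] and of the second one at [s''], where both particles
are lowered, cancel. The configuration [s'] where only [emm j] is lowered links
them, as the residues of the third product at [s] and [s''] are opposite. *)
Lemma cancel_top_bot s s' s'' i j : i = j :> nat ->
  interlacing s -> interlacing s' -> interlacing s'' ->
  lowers_emm s s' j -> lowers_ell s' s'' i ->
  ell theta s i = emm theta s j -> let a := L s i in
  phit a * (iota (W s) * res_top s i) + phib a * (iota (W s'') * res_bot s'' j) = 0.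
Proof.
move=> ij hs hs' hs'' low low' le a.
have h1 := cancel_top_mid hs' hs'' low'; have h2 := cancel_mid_bot hs hs' low.
have [ej ek el] := lowers_emmE theta low; have [ei' ek' em'] := lowers_ellE theta low'.
have rt : res_top s' i = res_top s i.
  by rewrite /res_top; congr (_ * _); apply: eq_bigr => k _; rewrite !el.
have rb : res_bot s' j = res_bot s'' j.
  by rewrite /res_bot; congr (_ * _); apply: eq_bigr => k _; rewrite !em'.
have rm : res_mid_ell s'' i = - res_mid_emm s j.
  rewrite /res_mid_ell /res_mid_emm -mulNr opprB; congr (_ * _).
  have e1 : L s'' i = a - 1 by rewrite ei' el rmorphB rmorph1.
  have e2 : E s j = a by rewrite -le.
  rewrite e1 e2 (bigD1 j (P := xpredT)) //= (bigD1 i (P := xpredT)) //=.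
  have -> : E s'' j = a - 1 by rewrite em' ej -le rmorphB rmorph1.
  rewrite mulrCA !mulrA; congr (_ * _ * _).
  - rewrite -/a (_ : a - 1 + 1 - (a - 1) = 1); last ring.
    by rewrite !subrr !sub0r add0r divr1 invrN invr1 mulrN1 opprK.
  - apply: eq_bigr => k ki; rewrite ek' // el; congr (_ / _); ring.
  - apply: eq_bigr => k kj; rewrite em' ek //; congr (_ / _); ring.
rewrite rm in h1; rewrite rt el -/a in h1; rewrite -le rb -/a in h2.
have w0 : iota (W s') != 0 by rewrite fmorph_eq0 W_neq0.
apply: (mulfI w0); rewrite mulr0 mulrDr.
have -> : iota (W s') * (phit a * (iota (W s) * res_top s i)) =
  iota (W s) * (phit a * (iota (W s') * res_top s i)) by ring.
have -> : iota (W s') * (phib a * (iota (W s'') * res_bot s'' j)) =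
  iota (W s'') * (phib a * (iota (W s') * res_bot s'' j)) by ring.
move/eqP: h1; rewrite addr_eq0 => /eqP ->.
move/eqP: h2; rewrite addrC addr_eq0 => /eqP ->.
by ring.
Qed.

End Residues.

(** * Moving one particle *)

Section Moves.
Variables (N M : nat).
Implicit Types (s : state N M) (i : 'I_N) (j : 'I_N.-1).

(** Moves of a single particle. The truncation in [inord] only matters when the
particle cannot move in the given direction. *)
Definition lower_ell i s : state N M :=
  ([ffun k => if k == i then inord (s.1 k).-1 else s.1 k], s.2).
Definition raise_ell i s : state N M :=
  ([ffun k => if k == i then inord (s.1 k).+1 else s.1 k], s.2).
Definition lower_emm j s : state N M :=
  (s.1, [ffun k => if k == j then inord (s.2 k).-1 else s.2 k]).
Definition raise_emm j s : state N M :=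
  (s.1, [ffun k => if k == j then inord (s.2 k).+1 else s.2 k]).

Lemma lower_ellP i s : (0 < s.1 i)%N -> lowers_ell s (lower_ell i s) i.
Proof.
move=> h; split => //= [|k ki]; last by rewrite ffunE (negPf ki).
by rewrite ffunE eqxx inordK ?prednK //; exact: ltnW.
Qed.

Lemma raise_ellP i s : (s.1 i < M)%N -> lowers_ell (raise_ell i s) s i.
Proof.
move=> h; split => //= [|k ki]; last by rewrite ffunE (negPf ki).
by rewrite ffunE eqxx inordK.
Qed.

Lemma lower_emmP j s : (0 < s.2 j)%N -> lowers_emm s (lower_emm j s) j.
Proof.
move=> h; split => //= [|k kj]; last by rewrite ffunE (negPf kj).
by rewrite ffunE eqxx inordK ?prednK //; exact: ltnW.
Qed.

Lemma raise_emmP j s : (s.2 j < M)%N -> lowers_emm (raise_emm j s) s j.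
Proof.
move=> h; split => //= [|k kj]; last by rewrite ffunE (negPf kj).
by rewrite ffunE eqxx inordK.
Qed.

Lemma lower_ellK i s : (0 < s.1 i)%N -> raise_ell i (lower_ell i s) = s.
Proof.
case: s => l m /= h; congr pair; apply/ffunP => k; rewrite !ffunE.
have [->|//] := eqVneq k i; apply: val_inj; rewrite /= !inordK ?prednK //; exact: ltnW.
Qed.

Lemma raise_ellK i s : (s.1 i < M)%N -> lower_ell i (raise_ell i s) = s.
Proof.
case: s => l m /= h; congr pair; apply/ffunP => k; rewrite !ffunE.
have [->|//] := eqVneq k i.
by rewrite (inordK (_ : (l i).+1 < M.+1)%N) //= inord_val.
Qed.

Lemma lower_emmK j s : (0 < s.2 j)%N -> raise_emm j (lower_emm j s) = s.
Proof.
case: s => l m /= h; congr pair; apply/ffunP => k; rewrite !ffunE.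
have [->|//] := eqVneq k j; apply: val_inj; rewrite /= !inordK ?prednK //; exact: ltnW.
Qed.

Lemma raise_emmK j s : (s.2 j < M)%N -> lower_emm j (raise_emm j s) = s.
Proof.
case: s => l m /= h; congr pair; apply/ffunP => k; rewrite !ffunE.
have [->|//] := eqVneq k j.
by rewrite (inordK (_ : (m j).+1 < M.+1)%N) //= inord_val.
Qed.

Lemma interlacing_lower_ell s s' i : interlacing s -> lowers_ell s s' i ->
  (forall j, i = j :> nat -> (s.2 j < s.1 i)%N) -> interlacing s'.
Proof.
move=> /interlacingP hs [e2 ei ek] h; apply/interlacingP => k j.
have [h1 h2] := hs k j; rewrite e2; have [ki|/ek -> //] := eqVneq k i.
subst k; split => e; first by have := h _ e; rewrite -ei ltnS.
by apply: leq_trans (h2 e); rewrite -ei.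
Qed.

Lemma interlacing_raise_ell s s' i : interlacing s' -> lowers_ell s s' i ->
  (forall j, i = j.+1 :> nat -> (s'.1 i < s'.2 j)%N) -> interlacing s.
Proof.
move=> /interlacingP hs [e2 ei ek] h; apply/interlacingP => k j.
have [h1 h2] := hs k j; rewrite -e2; have [ki|/ek <- //] := eqVneq k i.
subst k; split => e; last by have := h _ e; rewrite -ei.
by apply: leq_trans (h1 e) _; rewrite -ei.
Qed.

Lemma interlacing_lower_emm s s' j : interlacing s -> lowers_emm s s' j ->
  (forall i, i = j.+1 :> nat -> (s.1 i < s.2 j)%N) -> interlacing s'.
Proof.
move=> /interlacingP hs [e1 ej ek] h; apply/interlacingP => i k.
have [h1 h2] := hs i k; rewrite e1; have [kj|/ek -> //] := eqVneq k j.
subst k; split => e; last by have := h _ e; rewrite -ej ltnS.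
by apply: leq_trans (h1 e); rewrite -ej.
Qed.

Lemma interlacing_raise_emm s s' j : interlacing s' -> lowers_emm s s' j ->
  (forall i, i = j :> nat -> (s'.2 j < s'.1 i)%N) -> interlacing s.
Proof.
move=> /interlacingP hs [e1 ej ek] h; apply/interlacingP => i k.
have [h1 h2] := hs i k; rewrite -e1; have [kj|/ek <- //] := eqVneq k j.
subst k; split => e; first by have := h _ e; rewrite -ej.
by apply: leq_trans (h2 e) _; rewrite -ej.
Qed.

End Moves.

(** * Cancellation of the residues at a point *)

Section SumLemmas.
Variables (K : zmodType) (T : finType).
Implicit Types (P Q A : pred T) (f g : T -> K).

Lemma sum_cancel P Q f g (h h' : T -> T) :
  (forall s, P s -> Q (h s) /\ h' (h s) = s) ->
  (forall s, Q s -> P (h' s) /\ h (h' s) = s) ->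
  (forall s, P s -> f s + g (h s) = 0) ->
  \sum_(s | P s) f s + \sum_(s | Q s) g s = 0.
Proof.
move=> hP hQ hfg; rewrite [X in _ + X](reindex_onto h h'); last first.
  by move=> s Qs; have [] := hQ s Qs.
rewrite [X in _ + X](eq_bigl P) => [|s]; last first.
  apply/andP/idP => [[Qs /eqP e]|Ps]; first by have [] := hQ _ Qs; rewrite e.
  by have [-> ->] := hP _ Ps; rewrite eqxx.
by rewrite -big_split big1.
Qed.

Lemma sum_restrict A P f : (forall s, P s -> A s) ->
  (forall s, A s -> ~~ P s -> f s = 0) ->
  \sum_(s | A s) f s = \sum_(s | P s) f s.
Proof.
move=> PA h; rewrite (bigID P) /= [X in _ + X]big1 => [|s /andP[]]; last exact: h.
rewrite addr0; apply: eq_bigl => s.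
by apply/andP/idP => [[]//|Ps]; split => //; exact: PA.
Qed.

Lemma sum_restrict2 A P Q f : (forall s, P s -> A s) -> (forall s, Q s -> A s) ->
  (forall s, P s -> ~~ Q s) ->
  (forall s, A s -> ~~ P s -> ~~ Q s -> f s = 0) ->
  \sum_(s | A s) f s = \sum_(s | P s) f s + \sum_(s | Q s) f s.
Proof.
move=> PA QA PQ h; rewrite (bigID P) /=; congr (_ + _).
  apply: eq_bigl => s; by apply/andP/idP => [[]//|Ps]; split => //; exact: PA.
apply: (sum_restrict (A := fun s => A s && ~~ P s)).
  by move=> s Qs; rewrite QA //=; apply: contraL Qs; exact: PQ.
by move=> s /andP[As Ps] Qs; exact: h.
Qed.

End SumLemmas.

Section ResidueSum.
Variables (R : realType) (K : fieldType) (iota : {rmorphism R -> K}).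
Variables (N M : nat) (theta : R).
Implicit Types (s : state N M) (i : 'I_N) (j : 'I_N.-1).
Local Notation S := (M%:R + N.-1%:R * theta).
Local Notation t := (iota theta).
Local Notation L s i := (iota (ell theta s i)).
Local Notation E s j := (iota (emm theta s j)).

Lemma row_shiftS n : (n.+1 < N)%N -> row_shift N theta n = row_shift N theta n.+1 + theta.
Proof.
move=> h; rewrite /row_shift -[X in _ + X]mul1r -mulrDl natr1; congr (_%:R * _).
lia.
Qed.

(** The residue has a vanishing factor when the particle is as close as possible
to the next one of its row. The next three lemmas deal with the other residues
and the particles that block a move. *)
Lemma res_top_eq0 s i i' : i' = i.+1 :> nat -> s.1 i' = s.1 i ->
  res_top iota theta s i = 0.
Proof.
move=> ii' e; rewrite /res_top (bigD1 i') /=; last first.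
  by rewrite -val_eqE /= ii'; lia.
rewrite (_ : _ - t = 0) ?mul0r ?mulr0 //.
rewrite -!rmorphB (_ : _ - theta = 0) ?rmorph0 //.
have := @row_shiftS i; rewrite -ii' /row_shift => /(_ (ltn_ord i')).
by rewrite /ell e => ->; ring.
Qed.

Lemma res_bot_eq0 s j j' : j = j'.+1 :> nat -> s.2 j' = s.2 j ->
  res_bot iota theta s j = 0.
Proof.
move=> jj' e; rewrite /res_bot (bigD1 j') /=; last first.
  by rewrite -val_eqE /= jj'; lia.
rewrite (_ : _ + t = 0) ?mul0r ?mulr0 //.
rewrite -rmorphB -rmorphD (_ : _ + theta = 0) ?rmorph0 //.
have := @row_shiftS j'; rewrite -jj' /row_shift.
move=> /(_ (leq_trans (ltn_ord j) (leq_pred N))).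
by rewrite /emm e => ->; ring.
Qed.

Lemma res_mid_ell_eq0 s i j : i = j.+1 :> nat -> s.1 i = s.2 j ->
  res_mid_ell iota theta s i = 0.
Proof.
move=> ij e; rewrite /res_mid_ell [X in _ * (_ * X)](bigD1 j) //=.
rewrite (_ : L s i - E s j + t = 0) ?mul0r ?mulr0 //.
rewrite -rmorphB -rmorphD (_ : _ + theta = 0) ?rmorph0 //.
have := @row_shiftS j; rewrite -ij /row_shift => /(_ (ltn_ord i)).
by rewrite /ell /emm e => ->; ring.
Qed.

Lemma res_mid_emm_eq0 s i j : i = j.+1 :> nat -> s.1 i = s.2 j ->
  res_mid_emm iota theta s j = 0.
Proof.
move=> ij e; rewrite /res_mid_emm [X in _ * (X * _)](bigD1 i) //=.
rewrite (_ : E s j - L s i - t = 0) ?mul0r ?mulr0 ?mul0r ?mulr0 //.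
rewrite -!rmorphB (_ : _ - theta = 0) ?rmorph0 //.
have := @row_shiftS j; rewrite -ij /row_shift => /(_ (ltn_ord i)).
by rewrite /ell /emm e => ->; ring.
Qed.

End ResidueSum.

Section ResidueCancellation.
Variables (R : realType) (K : fieldType) (iota : {rmorphism R -> K}).
Variables (N M : nat) (theta : R).
Hypothesis theta_gt0 : 0 < theta.
Hypothesis theta_neq1 : theta != 1.
Implicit Types (s : state N M) (i : 'I_N) (j : 'I_N.-1).
Local Notation S := (M%:R + N.-1%:R * theta).

Variables (w tau : R -> R) (W : state N M -> R) (phit phib phim : K -> K).
Hypothesis hadm : admissible theta w tau W.
Hypothesis W_neq0 : forall s, interlacing s -> W s != 0.
Hypothesis w_gt0 : forall x : R, 0 <= x <= S -> 0 < w x.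
Hypothesis tau_gt0 : forall x : R, theta <= x <= S -> 0 < tau x.
Hypothesis ratio_top : forall z : R, 1 <= z <= S ->
  phit (iota z) / phim (iota z) = iota (w (z - 1) / w z).
Hypothesis ratio_bot : forall z : R, theta + 1 <= z <= S ->
  phib (iota z) / phim (iota z) = iota (tau z / tau (z - 1)).
Hypothesis phit0 : phit 0 = 0.
Hypothesis phibS : phib (iota (M%:R + 1 + N.-1%:R * theta)) = 0.
Hypothesis phimS : phim (iota (M%:R + 1 + N.-1%:R * theta)) = 0.

Local Notation c := (iota (theta / (1 - theta))).
Local Notation row_shift := (row_shift N theta).

Variables (i : 'I_N) (k : nat).
Let a := iota (k%:R + row_shift i).

Let top s := phit a * (iota (W s) * res_top iota theta s i).
Let mid_ell s := c * phim a * (iota (W s) * res_mid_ell iota theta s i).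
Let mid_emm j s := c * phim a * (iota (W s) * res_mid_emm iota theta s j).
Let bot j s := phib a * (iota (W s) * res_bot iota theta s j).

Let V s := interlacing s.

Let ell_a s : s.1 i = k :> nat -> ell theta s i = k%:R + row_shift i.
Proof. by rewrite /ell => ->. Qed.

Let emm_a s j : i = j :> nat -> s.2 j = k :> nat -> emm theta s j = k%:R + row_shift i.
Proof. by rewrite /emm /row_shift => -> ->. Qed.

(** Configurations whose [i]-th upper particle is at [k] and can be lowered, and
their images. *)
Let P1 s := [&& V s, s.1 i == k :> nat, (0 < k)%N & V (lower_ell i s)].
Let Q1 s := [&& V s, (s.1 i).+1 == k :> nat, (k <= M)%N & V (raise_ell i s)].

Let cancel1 : \sum_(s | P1 s) top s + \sum_(s | Q1 s) mid_ell s = 0.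
Proof.
apply: (@sum_cancel _ _ _ _ _ _ (lower_ell i) (raise_ell i)).
- move=> s /and4P[hs /eqP sk k0 hs']; rewrite /Q1.
  have s0 : (0 < s.1 i)%N by rewrite sk.
  have [_ e _] := lower_ellP s0.
  by rewrite lower_ellK // hs hs' e sk eqxx -sk -ltnS ltn_ord.
- move=> s /and4P[hs /eqP sk kM hs']; rewrite /P1.
  have s0 : (s.1 i < M)%N by rewrite sk.
  have [_ e _] := raise_ellP s0.
  by rewrite raise_ellK // hs hs' -e sk eqxx -sk.
- move=> s /and4P[hs /eqP sk k0 hs'].
  have s0 : (0 < s.1 i)%N by rewrite sk.
  have := cancel_top_mid theta_gt0 hadm w_gt0 theta_neq1 ratio_top hs hs' (lower_ellP s0).
  by rewrite (ell_a sk).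
Qed.

Let mid_ell_split : \sum_(s | V s && ((s.1 i).+1 == k :> nat)) mid_ell s =
  \sum_(s | Q1 s) mid_ell s.
Proof.
apply: sum_restrict; first by move=> s /and4P[-> ->].
move=> s /andP[hs sk] n1.
have j0 : (i : nat) = 0%N \/ (exists2 j' : 'I_N.-1, i = j'.+1 :> nat & True).
  case e : (i : nat) => [|n]; [by left|right].
  have hn : (n < N.-1)%N by have := ltn_ord i; rewrite e; lia.
  by exists (Ordinal hn).
have raise : (s.1 i < M)%N ->
    (forall j' : 'I_N.-1, i = j'.+1 :> nat -> (s.1 i < s.2 j')%N) -> Q1 s.
  move=> iM h; rewrite /Q1 hs sk -(eqP sk) iM /=.
  exact: (interlacing_raise_ell hs (raise_ellP iM)).
case: j0 => [i0|[j' ij' _]].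
  have [iM|Mi] := ltnP (s.1 i) M.
    by case/negP: n1; apply: raise => // j'; rewrite i0.
  have kE : k = M.+1.
    apply/eqP; rewrite -(eqP sk) eqSS eqn_leq Mi andbT -ltnS.
    exact: ltn_ord.
  rewrite /mid_ell (_ : phim a = 0) ?mulr0 ?mul0r // /a /row_shift i0 kE -natr1.
  by rewrite subn1 phimS.
suff -> : mid_ell s = c * phim a * (iota (W s) * 0) by rewrite !mulr0.
congr (_ * (_ * _)); apply: (res_mid_ell_eq0 _ _ (i := i) (j := j')) => //.
apply: val_inj; apply/eqP; rewrite eqn_leq lam_le_mu ?ij' //= leqNgt.
apply: contra n1 => lt; apply: raise.
  by apply: leq_trans lt _; rewrite -ltnS.
move=> j; rewrite ij' => -[] /val_inj <-; exact: lt.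
Qed.

Section WithLower.
Variable j : 'I_N.-1.
Hypothesis ij : i = j :> nat.

Let P2 s := [&& V s, s.2 j == k :> nat, (0 < k)%N & V (lower_emm j s)].
Let Q2 s := [&& V s, (s.2 j).+1 == k :> nat, (k <= M)%N & V (raise_emm j s)].

Let cancel2 : \sum_(s | P2 s) mid_emm j s + \sum_(s | Q2 s) bot j s = 0.
Proof.
apply: (@sum_cancel _ _ _ _ _ _ (lower_emm j) (raise_emm j)).
- move=> s /and4P[hs /eqP sk k0 hs']; rewrite /Q2.
  have s0 : (0 < s.2 j)%N by rewrite sk.
  have [_ e _] := lower_emmP s0.
  by rewrite lower_emmK // hs hs' e sk eqxx -sk -ltnS ltn_ord.
- move=> s /and4P[hs /eqP sk kM hs']; rewrite /P2.
  have s0 : (s.2 j < M)%N by rewrite sk.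
  have [_ e _] := raise_emmP s0.
  by rewrite raise_emmK // hs hs' -e sk eqxx -sk.
- move=> s /and4P[hs /eqP sk k0 hs'].
  have s0 : (0 < s.2 j)%N by rewrite sk.
  have := cancel_mid_bot theta_gt0 hadm tau_gt0 theta_neq1 ratio_bot hs hs' (lower_emmP s0).
  by rewrite (emm_a ij sk).
Qed.

(** Configurations where the two particles of index [i] are both at [k] and can
only be lowered together. *)
Let P3 s := [&& V s, s.1 i == k :> nat, s.2 j == k :> nat, (0 < k)%N &
  V (lower_ell i (lower_emm j s))].
Let Q3 s := [&& V s, (s.1 i).+1 == k :> nat, (s.2 j).+1 == k :> nat, (k <= M)%N &
  V (raise_emm j (raise_ell i s))].

Let cancel3 : \sum_(s | P3 s) top s + \sum_(s | Q3 s) bot j s = 0.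
Proof.
apply: (@sum_cancel _ _ _ _ _ _ (fun s => lower_ell i (lower_emm j s))
  (fun s => raise_emm j (raise_ell i s))).
- move=> s /and5P[hs /eqP sk /eqP sk2 k0 hs']; rewrite /Q3.
  have s0 : (0 < (lower_emm j s).1 i)%N by rewrite sk.
  have s1 : (0 < s.2 j)%N by rewrite sk2.
  have [_ e _] := lower_ellP s0; have [_ e2 _] := lower_emmP s1.
  rewrite lower_ellK // lower_emmK // hs hs' e sk e2 sk2 !eqxx.
  by rewrite -sk -ltnS ltn_ord.
- move=> s /and5P[hs /eqP sk /eqP sk2 kM hs']; rewrite /P3.
  have s0 : (s.1 i < M)%N by rewrite sk.
  have s1 : ((raise_ell i s).2 j < M)%N by rewrite sk2.
  have [_ e _] := raise_ellP s0; have [_ e2 _] := raise_emmP s1.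
  rewrite raise_emmK // raise_ellK // hs hs' -e sk -e2 sk2 !eqxx.
  by rewrite -sk.
- move=> s /and5P[hs /eqP sk /eqP sk2 k0 hs'].
  have s0 : (0 < (lower_emm j s).1 i)%N by rewrite sk.
  have s1 : (0 < s.2 j)%N by rewrite sk2.
  have hs1 : interlacing (lower_emm j s).
    apply: (interlacing_lower_emm hs (lower_emmP s1)) => i' ij'.
    have [e2' _ ek] := lower_ellP s0; have [_ e2 _] := lower_emmP s1.
    have := lam_le_mu (i := i') (j := j) hs'; rewrite ij' => /(_ (leqnn _)).
    rewrite ek; last by rewrite -val_eqE /= ij ij'; lia.
    by rewrite e2' -ltnS e2.
  have := cancel_top_bot theta_gt0 hadm W_neq0 w_gt0 tau_gt0 theta_neq1 ratio_top
    ratio_bot ij hs hs1 hs' (lower_emmP s1) (lower_ellP s0).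
  by rewrite (ell_a sk) (emm_a ij sk2); apply.
Qed.

(* A particle that cannot be lowered is blocked by the one that follows it in the
interlacing order; if that one is blocked as well, the residue vanishes. *)
Let top_split : \sum_(s | V s && (s.1 i == k :> nat)) top s =
  \sum_(s | P1 s) top s + \sum_(s | P3 s) top s.
Proof.
apply: sum_restrict2.
- by move=> s /and4P[-> ->].
- by move=> s /and5P[-> ->].
- move=> s /and4P[hs /eqP sk k0 hs']; apply/negP => /and5P[_ _ /eqP sk2 _ _].
  have s0 : (0 < s.1 i)%N by rewrite sk.
  have [e2 e _] := lower_ellP s0.
  by have := mu_le_lam (i := i) (j := j) hs'; rewrite ij leqnn e2 sk2 -sk -e ltnn => /(_ isT).
move=> s /andP[hs sk] n1 n3.
suff -> : top s = phit a * (iota (W s) * 0) by rewrite !mulr0.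
congr (_ * (_ * _)).
have hi' : (i.+1 < N)%N by rewrite ij; case: (N) j => [|n] [].
have h2 : s.2 j = s.1 i :> nat.
  apply/eqP; rewrite eqn_leq mu_le_lam ?ij //= leqNgt.
  apply: contra n1 => lt; rewrite /P1 hs sk /=.
  have s0 : (0 < s.1 i)%N by apply: leq_ltn_trans lt.
  rewrite -(eqP sk) s0 /=; apply: (interlacing_lower_ell hs (lower_ellP s0)) => j'.
  by rewrite ij => /val_inj <-.
apply: (res_top_eq0 _ _ (i := i) (i' := Ordinal hi')) => //.
apply: val_inj; apply/eqP; rewrite eqn_leq /= -{1}h2.
rewrite lam_le_mu //= ?ij // leqNgt.
apply: contra n3 => lt; rewrite /P3 hs sk h2 sk /=.
have s1 : (0 < s.2 j)%N by rewrite h2; apply: leq_ltn_trans lt.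
rewrite -(eqP sk) -h2 s1 /=.
have hs1 : interlacing (lower_emm j s).
  apply: (interlacing_lower_emm hs (lower_emmP s1)) => i' ij'.
  by rewrite h2 (_ : i' = Ordinal hi') //; apply: val_inj; rewrite /= ij' ij.
have s0 : (0 < (lower_emm j s).1 i)%N by rewrite /= -h2.
apply: (interlacing_lower_ell hs1 (lower_ellP s0)) => j'.
have [e1 e2 _] := lower_emmP s1.
by rewrite ij => /val_inj <-; rewrite -ltnS e2 h2.
Qed.

Let mid_emm_split : \sum_(s | V s && (s.2 j == k :> nat)) mid_emm j s =
  \sum_(s | P2 s) mid_emm j s.
Proof.
apply: sum_restrict; first by move=> s /and4P[-> ->].
move=> s /andP[hs sk] n2.
suff -> : mid_emm j s = c * phim a * (iota (W s) * 0) by rewrite !mulr0.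
congr (_ * (_ * _)).
have hi' : (j.+1 < N)%N by case: (N) j => [|n] [].
apply: (res_mid_emm_eq0 _ _ (i := Ordinal hi')) => //.
apply: val_inj; apply/eqP; rewrite eqn_leq lam_le_mu //= leqNgt.
apply: contra n2 => lt; rewrite /P2 hs sk /=.
have s1 : (0 < s.2 j)%N by apply: leq_ltn_trans lt.
rewrite -(eqP sk) s1 /=; apply: (interlacing_lower_emm hs (lower_emmP s1)) => i' ij'.
by rewrite (_ : i' = Ordinal hi') //; apply: val_inj.
Qed.

Let bot_split : \sum_(s | V s && ((s.2 j).+1 == k :> nat)) bot j s =
  \sum_(s | Q2 s) bot j s + \sum_(s | Q3 s) bot j s.
Proof.
apply: sum_restrict2.
- by move=> s /and4P[-> ->].
- by move=> s /and5P[-> _ ->].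
- move=> s /and4P[hs /eqP sk kM hs']; apply/negP => /and5P[_ /eqP sk2 _ _ _].
  have s0 : (s.2 j < M)%N by rewrite sk.
  have [e2 e _] := raise_emmP s0.
  have := mu_le_lam (i := i) (j := j) hs'; rewrite ij leqnn -e sk -e2 -sk2 ltnn.
  by move=> /(_ isT).
move=> s /andP[hs sk] n2 n3.
have h2 : s.2 j = s.1 i :> nat.
  apply/eqP; rewrite eqn_leq mu_le_lam ?ij //= leqNgt.
  apply: contra n2 => lt; rewrite /Q2 hs sk /=.
  have s0 : (s.2 j < M)%N by apply: leq_trans lt _; rewrite -ltnS.
  rewrite -(eqP sk) s0 /=; apply: (interlacing_raise_emm hs (raise_emmP s0)) => i'.
  by rewrite -ij => /val_inj ->.
have [kM|kM] := leqP k M; last first.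
  have iM : (s.1 i <= M)%N by rewrite -ltnS.
  have kE : k = M.+1.
    by apply/eqP; rewrite eqn_leq kM andbT -(eqP sk) h2 ltnS.
  have j0 : (i : nat) = 0%N \/ (exists2 j' : 'I_N.-1, i = j'.+1 :> nat & True).
    case e : (i : nat) => [|n]; [by left|right].
    have hn : (n < N.-1)%N by have := ltn_ord i; rewrite e; lia.
    by exists (Ordinal hn).
  case: j0 => [i0|[j' ij' _]].
    rewrite /bot (_ : phib a = 0) ?mul0r // /a /row_shift i0 kE -natr1.
    by rewrite subn1 phibS.
  suff -> : bot j s = phib a * (iota (W s) * 0) by rewrite !mulr0.
  congr (_ * (_ * _)).
  apply: (res_bot_eq0 _ _ (j := j) (j' := j')); first by rewrite -ij.
  apply: val_inj; apply/eqP; rewrite eqn_leq /=; apply/andP; split; last first.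
    by rewrite mu_antimono // -ij ij'.
  have -> : s.2 j = M :> nat by move/eqP: sk; rewrite kE => -[].
  by rewrite -ltnS ltn_ord.
have iM : (s.1 i < M)%N by rewrite -h2 (eqP sk).
suff -> : bot j s = phib a * (iota (W s) * 0) by rewrite !mulr0.
congr (_ * (_ * _)).
have raise : (forall j' : 'I_N.-1, i = j'.+1 :> nat -> (s.1 i < s.2 j')%N) -> Q3 s.
  move=> h; rewrite /Q3 hs sk -h2 sk kM /=.
  have hs1 : interlacing (raise_ell i s).
    exact: (interlacing_raise_ell hs (raise_ellP iM)).
  have s1 : ((raise_ell i s).2 j < M)%N by rewrite /= h2.
  apply: (interlacing_raise_emm hs1 (raise_emmP s1)) => i'.
  have [_ e _] := raise_ellP iM.
  by rewrite -ij => /val_inj ->; rewrite -e /= h2.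
have [j' ij' le] : exists2 j' : 'I_N.-1, i = j'.+1 :> nat & (s.2 j' <= s.1 i)%N.
  case e : (i : nat) => [|n].
    by case/negP: n3; apply: raise => j'; rewrite e.
  have hn : (n < N.-1)%N by have := ltn_ord i; rewrite e; lia.
  exists (Ordinal hn); rewrite // leqNgt; apply: contra n3 => lt.
  by apply: raise => j'; rewrite e => -[] /(@val_inj _ _ _ (Ordinal hn)) <-.
apply: (res_bot_eq0 _ _ (j := j) (j' := j')); first by rewrite -ij.
apply: val_inj; apply/eqP; rewrite eqn_leq /= h2 le /= -h2.
by rewrite mu_antimono // -ij ij'.
Qed.

(** The residues at [a] that come from the two particles of index [i]. *)
Lemma residue_sum_pair :
  \sum_(s | V s && (s.1 i == k :> nat)) top s +
  \sum_(s | V s && ((s.1 i).+1 == k :> nat)) mid_ell s +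
  (\sum_(s | V s && (s.2 j == k :> nat)) mid_emm j s +
   \sum_(s | V s && ((s.2 j).+1 == k :> nat)) bot j s) = 0.
Proof.
rewrite top_split mid_ell_split mid_emm_split bot_split.
rewrite [X in X + _]addrAC cancel1 add0r.
by rewrite [X in _ + X]addrA cancel2 add0r cancel3.
Qed.

End WithLower.

Let top_last : (forall j, i <> j :> nat) ->
  \sum_(s | V s && (s.1 i == k :> nat)) top s = \sum_(s | P1 s) top s.
Proof.
move=> hj; apply: sum_restrict; first by move=> s /and4P[-> ->].
move=> s /andP[hs sk] n1.
have iN : i.+1 = N.
  apply/eqP; rewrite eqn_leq ltn_ord /= leqNgt; apply/negP => h.
  have hi : (i < N.-1)%N by rewrite -ltnS (leq_trans h) // leqSpred.
  exact: (hj (Ordinal hi)).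
have k0 : k = 0%N.
  apply/eqP; rewrite -leqn0 leqNgt; apply: contra n1 => k0.
  have s0 : (0 < s.1 i)%N by rewrite (eqP sk).
  rewrite /P1 hs sk k0; apply: (interlacing_lower_ell hs (lower_ellP s0)) => j ij.
  by case: (hj j).
by rewrite /top (_ : a = 0) ?phit0 ?mul0r // /a /row_shift iN k0 subnn mul0r addr0 rmorph0.
Qed.

(** The residues of the observable at [a] that come from the particles of index
[i]: those of the lower row exist unless [i] is the last index. *)
Lemma residue_sum_eq0 :
  phit a * (\sum_(s | interlacing s && (s.1 i == k :> nat))
              iota (W s) * res_top iota theta s i) +
  c * phim a * (\sum_(s | interlacing s && ((s.1 i).+1 == k :> nat))
              iota (W s) * res_mid_ell iota theta s i) +
  \sum_(j < N.-1 | i == j :> nat)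
    (c * phim a * (\sum_(s | interlacing s && (s.2 j == k :> nat))
              iota (W s) * res_mid_emm iota theta s j) +
     phib a * (\sum_(s | interlacing s && ((s.2 j).+1 == k :> nat))
              iota (W s) * res_bot iota theta s j)) = 0.
Proof.
rewrite !mulr_sumr.
under [\sum_(j < N.-1 | _) _]eq_bigr do rewrite !mulr_sumr.
have [hi|hi] := ltnP i N.-1.
  pose j := Ordinal hi; have ij : i = j :> nat by [].
  rewrite (big_pred1 j) => [|l /=]; last by rewrite -val_eqE eq_sym.
  exact: residue_sum_pair.
have hj j : i <> j :> nat by move=> ij; have := ltn_ord j; rewrite -ij ltnNge hi.
rewrite big_pred0 ?addr0 => [|j]; last by apply/eqP.
by rewrite top_last // mid_ell_split cancel1.
Qed.

End ResidueCancellation.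

(** * Partial fractions of the observable *)

Section Observable.
Variables (R : realType) (K : fieldType) (iota : {rmorphism R -> K}).
Variables (N M : nat) (theta : R).
Implicit Types (s : state N M) (i : 'I_N) (j : 'I_N.-1) (z : K).
Local Notation t := (iota theta).
Local Notation c := (iota (theta / (1 - theta))).
Local Notation L s i := (iota (ell theta s i)).
Local Notation E s j := (iota (emm theta s j)).

(** The three products of which the observable is an average. *)
Definition prod_top s z : K := \prod_(i < N) ((z - L s i - t) / (z - L s i)).
Definition prod_bot s z : K :=
  \prod_(j < N.-1) ((z - E s j + t - 1) / (z - E s j - 1)).
Definition prod_mid s z : K :=
  (\prod_(i < N) ((z - L s i - t) / (z - L s i - 1))) *
  \prod_(j < N.-1) ((z - E s j + t - 1) / (z - E s j)).

(** The function [R1] for a measure with weights [W]. *)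
Definition observable (W : state N M -> R) (phit phib phim : K -> K) z : K :=
  phit z * (\sum_(s | interlacing s) iota (W s) * prod_top s z) +
  phib z * (\sum_(s | interlacing s) iota (W s) * prod_bot s z) +
  c * phim z * \sum_(s | interlacing s) iota (W s) * prod_mid s z.

Hypothesis theta_gt0 : 0 < theta.

Lemma card_inj_le1 (T : finType) (f : T -> K) b : injective f ->
  (#|[pred x | f x == b]| <= 1)%N.
Proof.
move=> fI; apply/card_le1_eqP => x y; rewrite !inE => /eqP fx /eqP fy.
by apply: fI; rewrite fx fy.
Qed.

Lemma ell_inj s : interlacing s -> injective (ell theta s).
Proof.
move=> hs i i' e; apply: contraTeq isT => ii'.
by have := ell_neq theta_gt0 hs ii'; rewrite e eqxx.
Qed.

Lemma emm_inj s : interlacing s -> injective (emm theta s).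
Proof.
move=> hs i i' e; apply: contraTeq isT => ii'.
by have := emm_neq theta_gt0 hs ii'; rewrite e eqxx.
Qed.

Lemma prod_topE s z : interlacing s -> (forall i, z != L s i) ->
  prod_top s z = 1 + \sum_i res_top iota theta s i / (z - L s i).
Proof.
move=> hs hz.
have := @partial_fractions_fin K _ (fun i => L s i + t) (fun i => L s i) z hz.
rewrite /prod_top /res_top => pf.
under eq_bigr => i _ do rewrite -addrA -opprD.
rewrite pf => [|b b1].
  congr (1 + _); apply: eq_bigr => i _; rewrite opprD addNKr; congr (_ * _ / _).
  by apply: eq_bigr => k _; rewrite opprD addrA.
suff : (#|[pred i | L s i == b]| <= 1)%N by rewrite leqNgt b1.
by apply: card_inj_le1 => i i' /fmorph_inj; exact: ell_inj.
Qed.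

Lemma prod_botE s z : interlacing s -> (forall j, z != E s j + 1) ->
  prod_bot s z = 1 + \sum_j res_bot iota theta s j / (z - (E s j + 1)).
Proof.
move=> hs hz.
have := @partial_fractions_fin K _ (fun j => E s j + 1 - t) (fun j => E s j + 1) z hz.
rewrite /prod_bot /res_bot => pf.
have -> : \prod_(j < N.-1) ((z - E s j + t - 1) / (z - E s j - 1)) =
  \prod_(j < N.-1) ((z - (E s j + 1 - t)) / (z - (E s j + 1))).
  by apply: eq_bigr => j _; congr (_ / _); ring.
rewrite pf => [|b b1].
  congr (1 + _); apply: eq_bigr => j _; congr (_ * _ / _); first by ring.
  by apply: eq_bigr => k _; congr (_ / _); ring.
suff : (#|[pred j | (E s j + 1)%R == b]| <= 1)%N by rewrite leqNgt b1.
by apply: card_inj_le1 => j j' /addIr /fmorph_inj; exact: emm_inj.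
Qed.

(** When [ell i + 1] and [emm j] coincide, [j < i] and all the integer parts
between them in the interlacing order are equal, which produces a double zero of
the numerator at that point. *)
Lemma coincidence s i j : interlacing s -> ell theta s i + 1 = emm theta s j ->
  (exists i', ell theta s i' + theta = emm theta s j) /\
  (exists j', emm theta s j' + 1 - theta = emm theta s j).
Proof.
have th := theta_gt0; move=> hs e.
have ji : (j < i)%N.
  by rewrite ltnNge; apply/negP => /(emm_le_ell theta_gt0 hs); rewrite -e; lra.
have le := lam_le_mu hs ji.
have mul : s.2 j = s.1 i :> nat.
  apply/eqP; rewrite eqn_leq le andbT -ltnS -(ltr_nat R) -natr1.
  have := row_shift_lt theta_gt0 ji (ltn_ord i).
  by move: e; rewrite /ell /emm /row_shift; lra.
have hi' : (j.+1 < N)%N by apply: leq_ltn_trans (ltn_ord i).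
have hj' : (i.-1 < N.-1)%N by have := ltn_ord i; lia.
split.
  exists (Ordinal hi'); rewrite /ell /emm /=.
  have -> : s.1 (Ordinal hi') = s.2 j.
    apply: val_inj; apply/eqP; rewrite eqn_leq lam_le_mu //= mul.
    exact: lam_antimono.
  by have := row_shiftS theta hi'; rewrite /row_shift => ->; rewrite addrA.
exists (Ordinal hj'); rewrite -e /ell /emm /=.
have -> : s.2 (Ordinal hj') = s.1 i.
  apply: val_inj; apply/eqP; rewrite eqn_leq lam_le_mu //= ?andbT -?mul.
    by rewrite mu_antimono //=; lia.
  by rewrite prednK //; lia.
have hi : (i.-1.+1 < N)%N by rewrite prednK //; lia.
have := row_shiftS theta hi; rewrite /row_shift => ->.
by rewrite prednK; [ring | lia].
Qed.

Lemma prod_midE s z : interlacing s -> (forall i, z != L s i + 1) ->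
  (forall j, z != E s j) ->
  prod_mid s z = 1 + \sum_i res_mid_ell iota theta s i / (z - (L s i + 1)) +
    \sum_j res_mid_emm iota theta s j / (z - E s j).
Proof.
move=> hs hz1 hz2.
pose alpha (x : 'I_N + 'I_N.-1) :=
  match x with inl i => L s i + t | inr j => E s j + 1 - t end.
pose beta (x : 'I_N + 'I_N.-1) :=
  match x with inl i => L s i + 1 | inr j => E s j end.
have hz x : z != beta x by case: x.
have pf := @partial_fractions_fin K _ alpha beta z hz.
have sumE (P : pred ('I_N + 'I_N.-1)) :
    #|P| = (#|[pred i | P (inl i)]| + #|[pred j | P (inr j)]|)%N.
  by rewrite -!sum1_card big_sumType.
have -> : prod_mid s z = \prod_x ((z - alpha x) / (z - beta x)).
  rewrite big_sumType /= /prod_mid; congr (_ * _); apply: eq_bigr => i _;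
  by congr (_ / _); ring.
rewrite pf => [|b].
  rewrite big_sumType /= addrA; congr (_ + _ + _).
    apply: eq_bigr => i _; rewrite /res_mid_ell; congr (_ * _ / _); first by ring.
    rewrite big_sumType /=; congr (_ * _).
      by apply: eq_bigr => k _; congr (_ / _); ring.
    by apply: eq_bigr => k _; congr (_ / _); ring.
  apply: eq_bigr => i _; rewrite /res_mid_emm; congr (_ * _ / _); first by ring.
  rewrite big_sumType /=; congr (_ * _).
    by apply: eq_bigr => k _; congr (_ / _); ring.
  by apply: eq_bigr => k _; congr (_ / _); ring.
have -> : #|[pred x | beta x == b]| =
  (#|[pred i | (L s i + 1)%R == b]| + #|[pred j | E s j == b]|)%N := sumE _.
have -> : #|[pred x | alpha x == b]| =
  (#|[pred i | (L s i + t)%R == b]| + #|[pred j | (E s j + 1 - t)%R == b]|)%N := sumE _.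
have c1 : (#|[pred i | (L s i + 1)%R == b]| <= 1)%N.
  by apply: card_inj_le1 => i i' /addIr /fmorph_inj; exact: ell_inj.
have c2 : (#|[pred j | E s j == b]| <= 1)%N.
  by apply: card_inj_le1 => j j' /fmorph_inj; exact: emm_inj.
move=> c3.
have d1 : (0 < #|[pred i | (L s i + 1)%R == b]|)%N by lia.
have d2 : (0 < #|[pred j | E s j == b]|)%N by lia.
have [l lE] := card_gt0P d1; have [j jE] := card_gt0P d2.
move: lE jE; rewrite !inE => /eqP el /eqP ej.
have [|[i' hi'] [j' hj']] := @coincidence s l j hs.
  by apply: (fmorph_inj iota); rewrite rmorphD rmorph1 el ej.
apply: leq_trans (leq_add c1 c2) _; apply: leq_add; apply/card_gt0P.
  by exists i'; rewrite inE -rmorphD hi' ej.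
by exists j'; rewrite inE -(rmorph1 iota) -rmorphD -rmorphB hj' ej.
Qed.

End Observable.

Section Decomposition.
Variables (R : realType) (K : fieldType) (iota : {rmorphism R -> K}).
Variables (N M : nat) (theta : R) (W : state N M -> R).
Hypothesis theta_gt0 : 0 < theta.
Implicit Types (s : state N M) (i : 'I_N) (j : 'I_N.-1) (z : K) (k : nat).
Local Notation c := (iota (theta / (1 - theta))).
Local Notation L s i := (iota (ell theta s i)).
Local Notation E s j := (iota (emm theta s j)).

Let a i k : K := iota (k%:R + row_shift N theta i).
Let Z : K := \sum_(s : state N M | interlacing s) iota (W s).
Let T i k : K := \sum_(s | interlacing s && (s.1 i == k :> nat))
  iota (W s) * res_top iota theta s i.
Let Ml i k : K := \sum_(s | interlacing s && ((s.1 i).+1 == k :> nat))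
  iota (W s) * res_mid_ell iota theta s i.
Let Mm j k : K := \sum_(s | interlacing s && (s.2 j == k :> nat))
  iota (W s) * res_mid_emm iota theta s j.
Let B j k : K := \sum_(s | interlacing s && ((s.2 j).+1 == k :> nat))
  iota (W s) * res_bot iota theta s j.

Let sum_by_value (F : state N M -> K) (f : state N M -> nat) :
  (forall s, (f s < M.+2)%N) ->
  \sum_(s | interlacing s) F s =
  \sum_(k < M.+2) \sum_(s | interlacing s && (f s == k)) F s.
Proof.
by move=> hf; rewrite (partition_big (fun s => Ordinal (hf s)) xpredT) //=.
Qed.

Let sum_by_index (F : 'I_N.-1 -> K) :
  \sum_(j < N.-1) F j = \sum_(i < N) \sum_(j < N.-1 | i == j :> nat) F j.
Proof.
rewrite (partition_big (widen_ord (leq_pred N)) xpredT) //=.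
by apply: eq_bigr => i _; apply: eq_bigl => j; rewrite -val_eqE eq_sym.
Qed.

Let sum_residues (I : finType) (res : state N M -> I -> K)
    (f : state N M -> I -> nat) (p : I -> nat -> K) (q : state N M -> I -> K) z :
  (forall s x, (f s x < M.+2)%N) -> (forall s x, q s x = p x (f s x)) ->
  \sum_(s | interlacing s) iota (W s) * (\sum_x res s x / (z - q s x)) =
  \sum_x \sum_(k < M.+2)
    (\sum_(s | interlacing s && (f s x == k)) iota (W s) * res s x) / (z - p x k).
Proof.
move=> hf hq; under eq_bigr do rewrite mulr_sumr.
rewrite exchange_big /=; apply: eq_bigr => x _.
rewrite (@sum_by_value _ (f^~ x)) //; apply: eq_bigr => k _.
rewrite mulr_suml; apply: eq_bigr => s /andP[_ /eqP e].
by rewrite hq e mulrA.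
Qed.

Let off_poles z := forall s, interlacing s ->
  [/\ forall i, z != L s i, forall i, z != L s i + 1,
      forall j, z != E s j & forall j, z != E s j + 1].

Let a_ell s i : L s i = a i (s.1 i).
Proof. by []. Qed.

Let a_ell1 s i : L s i + 1 = a i (s.1 i).+1.
Proof.
rewrite -(rmorph1 iota) -rmorphD /a -natr1 /ell /row_shift.
by congr (iota _); ring.
Qed.

Let b j k : K := iota (k%:R + row_shift N theta j).

Let b_emm s j : E s j = b j (s.2 j).
Proof. by []. Qed.

Let b_emm1 s j : E s j + 1 = b j (s.2 j).+1.
Proof.
rewrite -(rmorph1 iota) -rmorphD /b -natr1 /emm /row_shift.
by congr (iota _); ring.
Qed.

Let sum_b (F : 'I_N.-1 -> nat -> K) z :
  \sum_(j < N.-1) \sum_(k < M.+2) F j k / (z - b j k) =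
  \sum_(i < N) \sum_(k < M.+2) (\sum_(j < N.-1 | i == j :> nat) F j k) / (z - a i k).
Proof.
rewrite sum_by_index; apply: eq_bigr => i _; rewrite exchange_big /=.
apply: eq_bigr => k _; rewrite mulr_suml; apply: eq_bigr => j /eqP ij.
by rewrite /a /b ij.
Qed.

(** The points [a i k] are the possible positions of the particles of index [i],
in either row; they need not be distinct for different [i]. *)
Lemma observable_decomposition phit phib phim z : off_poles z ->
  observable iota theta W phit phib phim z =
  Z * (phit z + phib z + c * phim z) +
  \sum_(i < N) \sum_(k < M.+2)
    (phit z * T i k + c * phim z * Ml i k +
     \sum_(j < N.-1 | i == j :> nat) (c * phim z * Mm j k + phib z * B j k)) /
    (z - a i k).
Proof.
move=> hz; rewrite /observable.
have ltM (k : 'I_M.+1) : (k < M.+2)%N := ltnW (ltn_ord k).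
have ltM1 (k : 'I_M.+1) : (k.+1 < M.+2)%N by rewrite ltnS ltn_ord.
have -> : \sum_(s | interlacing s) iota (W s) * prod_top iota theta s z =
    Z + \sum_(i < N) \sum_(k < M.+2) T i k / (z - a i k).
  rewrite -(@sum_residues _ (res_top iota theta) (fun s i => s.1 i) a _ z _ a_ell) //.
  rewrite -big_split; apply: eq_bigr => s hs /=; have [h _ _ _] := hz s hs.
  by rewrite prod_topE // mulrDr mulr1.
have -> : \sum_(s | interlacing s) iota (W s) * prod_bot iota theta s z =
    Z + \sum_(i < N) \sum_(k < M.+2) (\sum_(j < N.-1 | i == j :> nat) B j k) / (z - a i k).
  rewrite -sum_b.
  rewrite -(@sum_residues _ (res_bot iota theta) (fun s j => (s.2 j).+1) b _ z _ b_emm1) //.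
  rewrite -big_split; apply: eq_bigr => s hs /=; have [_ _ _ h] := hz s hs.
  by rewrite prod_botE // mulrDr mulr1.
have -> : \sum_(s | interlacing s) iota (W s) * prod_mid iota theta s z =
    Z + (\sum_(i < N) \sum_(k < M.+2) Ml i k / (z - a i k) +
    \sum_(i < N) \sum_(k < M.+2) (\sum_(j < N.-1 | i == j :> nat) Mm j k) / (z - a i k)).
  rewrite -sum_b.
  rewrite -(@sum_residues _ (res_mid_ell iota theta) (fun s i => (s.1 i).+1) a _ z _ a_ell1) //.
  rewrite -(@sum_residues _ (res_mid_emm iota theta) (fun s j => s.2 j) b _ z _ b_emm) //.
  rewrite -!big_split; apply: eq_bigr => s hs /=; have [_ h1 h2 _] := hz s hs.
  by rewrite prod_midE // !mulrDr mulr1 addrA.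
have -> : \sum_(i < N) \sum_(k < M.+2)
    (phit z * T i k + c * phim z * Ml i k +
     \sum_(j < N.-1 | i == j :> nat) (c * phim z * Mm j k + phib z * B j k)) /
    (z - a i k) =
  phit z * (\sum_(i < N) \sum_(k < M.+2) T i k / (z - a i k)) +
  c * phim z * (\sum_(i < N) \sum_(k < M.+2) Ml i k / (z - a i k)) +
  (c * phim z *
    (\sum_(i < N) \sum_(k < M.+2) (\sum_(j < N.-1 | i == j :> nat) Mm j k) / (z - a i k)) +
  phib z *
    (\sum_(i < N) \sum_(k < M.+2) (\sum_(j < N.-1 | i == j :> nat) B j k) / (z - a i k))).
  rewrite !mulr_sumr -!big_split; apply: eq_bigr => i _ /=.
  rewrite !mulr_sumr -!big_split; apply: eq_bigr => k _ /=.
  by rewrite big_split /= -!mulr_sumr !mulrDl !mulrA.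
by ring.
Qed.

End Decomposition.

(** * Analyticity of the observable *)

Section ObservableAnalytic.
Variables (R : realType) (N M : nat) (theta : R).
Hypothesis theta_gt0 : 0 < theta.
Hypothesis theta_neq1 : theta != 1.
Local Notation S := (M%:R + N.-1%:R * theta).
Local Notation iota := (real_complex R).

(** All particles have the same integer part [k], so that every
possible position is an apparent pole. *)
Definition const_state (k : 'I_M.+1) : state N M := ([ffun => k], [ffun => k]).

Lemma interlacing_const_state k : interlacing (const_state k).
Proof. by apply/interlacingP => i j; rewrite !ffunE. Qed.

Variables (w tau : R -> R) (W : state N M -> R).
Variables (U : set (Cplx R)) (phit phib phim : Cplx R -> Cplx R).
Hypothesis hadm : admissible theta w tau W.
Hypothesis W_neq0 : forall s, interlacing s -> W s != 0.
Hypothesis w_gt0 : forall x : R, 0 <= x <= S -> 0 < w x.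
Hypothesis tau_gt0 : forall x : R, theta <= x <= S -> 0 < tau x.
Hypothesis hU : forall x : R, 0 <= x <= M%:R + 1 + N.-1%:R * theta -> U x%:C.
Hypotheses (hphit : analytic_in U phit) (hphib : analytic_in U phib)
  (hphim : analytic_in U phim).
Hypothesis ratio_top : forall z : R, 1 <= z <= S ->
  phit z%:C / phim z%:C = (w (z - 1) / w z)%:C.
Hypothesis ratio_bot : forall z : R, theta + 1 <= z <= S ->
  phib z%:C / phim z%:C = (tau z / tau (z - 1))%:C.
Hypothesis phit0 : phit 0 = 0.
Hypothesis phibS : phib (M%:R + 1 + N.-1%:R * theta)%:C = 0.
Hypothesis phimS : phim (M%:R + 1 + N.-1%:R * theta)%:C = 0.

(** Each term of the partial fraction expansion has a numerator that vanishes at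
its pole, by [residue_sum_eq0]. *)
Lemma observable_aur : analytic_up_to_removable U (R1_poles N M theta)
  (observable iota theta W phit phib phim).
Proof.
set c := iota (theta / (1 - theta)).
pose Z : Cplx R := \sum_(s : state N M | interlacing s) iota (W s).
pose T (i : 'I_N) (k : nat) : Cplx R :=
  \sum_(s : state N M | interlacing s && (s.1 i == k :> nat)) 
    iota (W s) * res_top iota theta s i.
pose Ml (i : 'I_N) (k : nat) : Cplx R :=
  \sum_(s : state N M | interlacing s && ((s.1 i).+1 == k :> nat))
    iota (W s) * res_mid_ell iota theta s i.
pose Mm (j : 'I_N.-1) (k : nat) : Cplx R :=
  \sum_(s : state N M | interlacing s && (s.2 j == k :> nat))
    iota (W s) * res_mid_emm iota theta s j.
pose B (j : 'I_N.-1) (k : nat) : Cplx R :=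
  \sum_(s : state N M | interlacing s && ((s.2 j).+1 == k :> nat))
    iota (W s) * res_bot iota theta s j.
pose a (i : 'I_N) (k : nat) : Cplx R := iota (k%:R + row_shift N theta i).
pose G (i : 'I_N) (k : nat) (z : Cplx R) : Cplx R :=
  T i k * phit z + c * Ml i k * phim z +
  ((\sum_(j < N.-1 | i == j :> nat) c * Mm j k) * phim z +
   (\sum_(j < N.-1 | i == j :> nat) B j k) * phib z).
have Ga i (k : 'I_M.+2) : analytic_in U (G i k).
  apply: analytic_in_add; apply: analytic_in_add; exact: analytic_in_scale.
have GE i k z : G i k z = phit z * T i k + c * phim z * Ml i k +
     \sum_(j < N.-1 | i == j :> nat) (c * phim z * Mm j k + phib z * B j k).
  rewrite /G big_split /= -!mulr_sumr; ring.
have G0 i (k : 'I_M.+2) : G i k (a i k) = 0.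
  rewrite GE; exact: (residue_sum_eq0 theta_gt0 theta_neq1 hadm W_neq0 w_gt0 tau_gt0
    ratio_top ratio_bot phit0 phibS phimS i k).
have Ua i (k : 'I_M.+2) : U (a i k).
  apply: hU; rewrite /row_shift; apply/andP; split.
    by rewrite addr_ge0 // mulr_ge0 // ltW.
  rewrite natr1; apply: lerD; first by rewrite ler_nat -ltnS.
  by rewrite ler_pM2r // ler_nat; lia.
have poles i (k : 'I_M.+2) : [set a i k] `<=` R1_poles N M theta.
  move=> _ ->; have [kM|kM] := ltnP k M.+1.
    exists (const_state (Ordinal kM)); first exact: interlacing_const_state.
    by left; exists i; left; rewrite /ell ffunE.
  exists (const_state ord_max); first exact: interlacing_const_state.
  left; exists i; right; rewrite /ell ffunE /= /a.
  have -> : (k : nat) = M.+1 by apply/eqP; rewrite eqn_leq kM -ltnS ltn_ord.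
  by rewrite -natr1 /row_shift addrAC.
pose H (z : Cplx R) := Z * (phit z + (phib z + c * phim z)).
have Ha : analytic_in U H.
  have h1 := analytic_in_scale c hphim.
  have h2 := analytic_in_add hphit (analytic_in_add hphib h1).
  exact: (analytic_in_scale Z h2).
apply: (aur_sub (P := R1_poles N M theta) (f := fun z =>
   H z + \sum_(i < N) \sum_(k < M.+2) G i k z / (z - a i k))) => //.
  apply: aur_add; first by apply: (aur_sub (aur_analytic Ha)).
  apply: aur_sum => i; apply: aur_sum => k.
  apply: (aur_sub (aur_div (Ga i k) (Ua i k) (G0 i k))); first exact: poles.
  by [].
move=> z _ nz; rewrite observable_decomposition //.
  rewrite /H addrA; congr (_ + _); apply: eq_bigr => i _; apply: eq_bigr => k _.
  by rewrite GE.
move=> s hs; split=> x; apply/eqP => zE; apply: nz; exists s => //.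
- by left; exists x; left.
- by left; exists x; right; rewrite zE -(rmorph1 iota) -rmorphD.
- by right; exists x; left.
- by right; exists x; right; rewrite zE -(rmorph1 iota) -rmorphD.
Qed.

End ObservableAnalytic.

(** * The reflection of configurations *)

Section Reflection.
Variables (R : realType) (N M : nat) (theta : R).
Implicit Types (s : state N M) (i k : 'I_N) (j : 'I_N.-1).
Local Notation S := (M%:R + N.-1%:R * theta).

(** The configuration seen upside down: [ell] becomes [S - ell] and [emm] becomes
[S + theta - emm], where [S = M + (N - 1) * theta], and indices are reversed. *)
Definition refl s : state N M :=
  ([ffun i => rev_ord (s.1 (rev_ord i))], [ffun j => rev_ord (s.2 (rev_ord j))]).

Lemma reflK : involutive refl.
Proof.
by case=> l m; congr pair; apply/ffunP => i; rewrite !ffunE !rev_ordK.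
Qed.

Lemma interlacing_refl s : interlacing s -> interlacing (refl s).
Proof.
move=> hs; apply/interlacingP => i j; rewrite !ffunE /=; split => e.
  rewrite leq_sub2l // ltnS lam_le_mu //= e.
  by have := ltn_ord i; have := ltn_ord j; lia.
rewrite leq_sub2l // ltnS mu_le_lam //= e.
by have := ltn_ord i; have := ltn_ord j; lia.
Qed.

Lemma sum_refl (V : nmodType) (f : state N M -> V) :
  \sum_(s | interlacing s) f s = \sum_(s | interlacing s) f (refl s).
Proof.
rewrite (reindex_inj (inv_inj reflK)); apply: eq_bigl => s.
by apply/idP/idP => /interlacing_refl //; rewrite reflK.
Qed.

Lemma ell_refl s i : ell theta (refl s) i = S - ell theta s (rev_ord i).
Proof.
rewrite /ell ffunE /= subSS natrB; last by rewrite -ltnS.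
have -> : N.-1%:R = (N - i.+1)%:R + (N - (N - i.+1).+1)%:R :> R.
  by rewrite -natrD; congr _%:R; have := ltn_ord i; lia.
by ring.
Qed.

Lemma emm_refl s j : emm theta (refl s) j = S + theta - emm theta s (rev_ord j).
Proof.
rewrite /emm ffunE /= subSS natrB; last by rewrite -ltnS.
have -> : S + theta = M%:R + N.-1.+1%:R * theta by rewrite -natr1; ring.
have -> : N.-1.+1%:R = (N - j.+1)%:R + (N - (N.-1 - j.+1).+1)%:R :> R.
  by rewrite -natrD; congr _%:R; have := ltn_ord j; lia.
by ring.
Qed.

Lemma lowers_ell_refl s s' i : lowers_ell s s' i ->
  lowers_ell (refl s') (refl s) (rev_ord i).
Proof.
move=> [e2 ei ek]; split; first by rewrite /= e2.
  rewrite !ffunE rev_ordK /= -ei !subSS.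
  by have := ltn_ord (s.1 i); rewrite -ei; lia.
by move=> k ki; rewrite !ffunE ek // -(inj_eq rev_ord_inj) rev_ordK.
Qed.

Lemma lowers_emm_refl s s' j : lowers_emm s s' j ->
  lowers_emm (refl s') (refl s) (rev_ord j).
Proof.
move=> [e2 ei ek]; split; first by rewrite /= e2.
  rewrite !ffunE rev_ordK /= -ei !subSS.
  by have := ltn_ord (s.2 j); rewrite -ei; lia.
by move=> k ki; rewrite !ffunE ek // -(inj_eq rev_ord_inj) rev_ordK.
Qed.

Lemma prod_rev_opp (K : comPzRingType) n (F G : 'I_n -> K) :
  (forall k : 'I_n, F (rev_ord k) = - G k) ->
  \prod_(k < n) F k = (-1) ^+ n * \prod_(k < n) G k.
Proof.
move=> h; rewrite (reindex_inj rev_ord_inj) /=.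
by under eq_bigr do rewrite h; rewrite prodrN card_ord.
Qed.

Lemma prod_rev_opp_except (K : comPzRingType) n (i : 'I_n) (F G : 'I_n -> K) :
  (forall k : 'I_n, k != i -> F (rev_ord k) = - G k) ->
  \prod_(k < n | k != rev_ord i) F k =
  (-1) ^+ #|predC1 i| * \prod_(k < n | k != i) G k.
Proof.
move=> h; rewrite (reindex_inj rev_ord_inj) /=.
under eq_bigl do rewrite (inj_eq rev_ord_inj).
by rewrite -prodrN; apply: eq_bigr.
Qed.

Lemma cancel_signs (K : fieldType) (e e' x y p1 p2 p3 p4 : K) :
  e != 0 -> e' != 0 ->
  x * ((e * p1) * (e' * p2)) = y * ((e * p3) * (e' * p4)) ->
  y * (p3 * p4) = x * (p1 * p2).
Proof.
move=> e0 e0' h; apply: (mulfI (mulf_neq0 e0 e0')).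
transitivity (y * ((e * p3) * (e' * p4))); first by ring.
by rewrite -h; ring.
Qed.

Lemma admissible_refl (w tau : R -> R) (W : state N M -> R) :
  admissible theta w tau W ->
  admissible theta (fun x => w (S - x)) (fun x => tau (S + theta - x)) (W \o refl).
Proof.
(* Reflection turns lowering into raising, so the relation between [s] and [s']
   comes from the one between [refl s'] and [refl s]. *)
have sign0 n : (-1) ^+ n != 0 :> R by rewrite expf_neq0 // oppr_eq0 oner_eq0.
move=> hadm; split=> [s s' i|s s' j] hs hs' low a /=.
  have h := adm_ell hadm (interlacing_refl hs') (interlacing_refl hs) (lowers_ell_refl low).
  have [ei ek em] := lowers_ellE theta low.
  rewrite /= ell_refl rev_ordK ei -/a in h.
  rewrite (_ : S - (a - 1) - 1 = S - a) in h; last ring.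
  rewrite [in LHS](prod_rev_opp_except
    (G := fun k => a - 1 - ell theta s k)) in h; last first.
    by move=> k ki; rewrite ell_refl rev_ordK ek //; ring.
  rewrite [in RHS](prod_rev_opp_except
    (G := fun k => a - ell theta s k)) in h; last first.
    by move=> k ki; rewrite ell_refl rev_ordK ek //; ring.
  rewrite [in LHS](prod_rev_opp
    (G := fun j => a - emm theta s j)) in h; last first.
    by move=> j; rewrite emm_refl rev_ordK em; ring.
  rewrite [in RHS](prod_rev_opp
    (G := fun j => a - emm theta s j + theta - 1)) in h; last first.
    by move=> j; rewrite emm_refl rev_ordK em; ring.
  exact: cancel_signs h.
have h := adm_emm hadm (interlacing_refl hs') (interlacing_refl hs) (lowers_emm_refl low).
have [ej ek el] := lowers_emmE theta low.
rewrite /= emm_refl rev_ordK ej -/a in h.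
rewrite (_ : S + theta - (a - 1) - 1 = S + theta - a) in h; last ring.
rewrite [in LHS](prod_rev_opp_except
  (G := fun l => a - 1 - emm theta s l)) in h; last first.
  by move=> k kj; rewrite emm_refl rev_ordK ek //; ring.
rewrite [in RHS](prod_rev_opp_except
  (G := fun l => a - emm theta s l)) in h; last first.
  by move=> k kj; rewrite emm_refl rev_ordK ek //; ring.
rewrite [in LHS](prod_rev_opp
  (G := fun i => a - ell theta s i - theta)) in h; last first.
  by move=> i; rewrite ell_refl rev_ordK el; ring.
rewrite [in RHS](prod_rev_opp
  (G := fun i => a - 1 - ell theta s i)) in h; last first.
  by move=> i; rewrite ell_refl rev_ordK el; ring.
exact: cancel_signs h.
Qed.

Section ReflectedProducts.
Variables (K : fieldType) (iota : {rmorphism R -> K}).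
Local Notation t := (iota theta).
Local Notation sN := (iota (M%:R + 1 + N.-1%:R * theta)).

Lemma div_opp (x y x' y' : K) : x' = - x -> y' = - y -> x' / y' = x / y.
Proof. by move=> -> ->; rewrite invrN mulrNN. Qed.

Lemma prod_top_refl s z :
  \prod_(i < N) ((z - iota (ell theta (refl s) i) + t - 1) /
                 (z - iota (ell theta (refl s) i) - 1)) =
  prod_top iota theta s (sN - z).
Proof.
rewrite (reindex_inj rev_ord_inj) /=; apply: eq_bigr => i _.
rewrite ell_refl rev_ordK rmorphB !rmorphD rmorph1.
by apply: div_opp; ring.
Qed.

Lemma prod_bot_refl s z :
  \prod_(j < N.-1) ((z - iota (emm theta (refl s) j)) /
                    (z - iota (emm theta (refl s) j) + t)) =
  prod_bot iota theta s (sN - z).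
Proof.
rewrite (reindex_inj rev_ord_inj) /=; apply: eq_bigr => j _.
rewrite emm_refl rev_ordK rmorphB !rmorphD rmorph1.
by apply: div_opp; ring.
Qed.

Lemma prod_mid_refl s z :
  \prod_(i < N) ((z - iota (ell theta (refl s) i) + t - 1) /
                 (z - iota (ell theta (refl s) i))) *
  \prod_(j < N.-1) ((z - iota (emm theta (refl s) j)) /
                    (z - iota (emm theta (refl s) j) + t - 1)) =
  prod_mid iota theta s (sN - z).
Proof.
rewrite /prod_mid; congr (_ * _).
  rewrite (reindex_inj rev_ord_inj) /=; apply: eq_bigr => i _.
  rewrite ell_refl rev_ordK rmorphB !rmorphD rmorph1.
  by apply: div_opp; ring.
rewrite (reindex_inj rev_ord_inj) /=; apply: eq_bigr => j _.
rewrite emm_refl rev_ordK rmorphB !rmorphD rmorph1.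
by apply: div_opp; ring.
Qed.

End ReflectedProducts.

End Reflection.

(** * The probability measure *)

Section Probability.
Variables (R : realType) (N M : nat) (theta : R) (w tau : R -> R).
Hypothesis theta_gt0 : 0 < theta.
Local Notation S := (M%:R + N.-1%:R * theta).
Hypothesis w_gt0 : forall x : R, 0 <= x <= S -> 0 < w x.
Hypothesis tau_gt0 : forall x : R, theta <= x <= S -> 0 < tau x.
Local Notation prob := (@prob R N M theta w tau).

Lemma prob_admissible : admissible theta w tau prob.
Proof.
have [h1 h2] := weight_admissible N M w tau theta_gt0.
have scale (r x y u v p q : R) : x * u * p = y * v * q ->
    (x / r * u) * p = (y / r * v) * q.
  by move=> e; rewrite !(mulrAC _ r^-1) e.
split=> [s s' i|s s' j] hs hs' low a; apply: scale; first exact: h1.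
exact: h2.
Qed.

Lemma prob_neq0 s : interlacing s -> prob s != 0.
Proof.
move=> hs.
have pos (s' : state N M) : interlacing s' -> 0 < weight theta w tau s'.
  by move=> hs'; exact: (weight_gt0 theta_gt0 w_gt0 tau_gt0 hs').
rewrite /prob /partition_function; move: (weight theta w tau) pos => f pos.
rewrite mulf_neq0 ?invr_eq0 ?gt_eqF ?pos //.
rewrite (bigD1 s) //=; apply: ltr_wpDr; last exact: pos.
by apply: sumr_ge0 => s' /andP[/pos/ltW].
Qed.

(** The second function is the first one for the reflected measure, seen from the
other end of the interval. *)
Lemma R2E phit phib phim (z : Cplx R) :
  let sN := (M%:R + 1 + N.-1%:R * theta)%:C in
  R2 N M theta w tau phit phib phim z =
  observable (real_complex R) theta (prob \o @refl N M)
    (fun x => phit (sN - x)) (fun x => phib (sN - x)) (fun x => phim (sN - x))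
    (sN - z).
Proof.
move=> sN; rewrite /R2 /observable (_ : sN - (sN - z) = z); last by rewrite opprB addrC subrK.
have expectE (f : state N M -> Cplx R) : expect theta w tau f =
    \sum_(s : state N M | interlacing s) (prob (refl s))%:C * f (refl s).
  exact: (sum_refl (fun s => (prob s)%:C * f s)).
rewrite !expectE; congr (_ * _ + _ * _ + _ * _ * _); apply: eq_bigr => s _;
  congr (_ * _).
- exact: prod_top_refl.
- exact: prod_bot_refl.
- exact: prod_mid_refl.
Qed.

Lemma R1_poles_refl (z : Cplx R) : R1_poles N M theta z ->
  R2_poles N M theta ((M%:R + 1 + N.-1%:R * theta)%:C - z).
Proof.
move=> [s hs h]; exists (refl s); first exact: interlacing_refl.
have e (x y : R) : M%:R + 1 + N.-1%:R * theta - x = y ->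
    (M%:R + 1 + N.-1%:R * theta)%:C - x%:C = y%:C by move=> <-; rewrite rmorphB.
case: h => -[i [] ->]; [left|left|right|right]; exists (rev_ord i).
- by right; apply: e; rewrite ell_refl rev_ordK; ring.
- by left; apply: e; rewrite ell_refl rev_ordK; ring.
- by right; apply: e; rewrite emm_refl rev_ordK; ring.
- by left; apply: e; rewrite emm_refl rev_ordK; ring.
Qed.

End Probability.

(** * The two functions are analytic *)

Theorem theorem1p4 (R : realType) (N M : nat) (theta : R)
  (hN : (2 <= N)%N) (hM : (1 <= M)%N)
  (htheta : 0 < theta) (htheta1 : theta != 1)
  (w tau : R -> R)
  (hw : forall x : R, 0 <= x <= M%:R + N.-1%:R * theta -> 0 < w x)
  (htau : forall x : R, theta <= x <= M%:R + N.-1%:R * theta -> 0 < tau x)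
  (U : set (Cplx R)) (hU : open U)
  (hsU : forall x : R, 0 <= x <= M%:R + 1 + N.-1%:R * theta -> U x%:C)
  (phit1 phib1 phim1 phit2 phib2 phim2 : Cplx R -> Cplx R)
  (hphit1 : analytic_in U phit1) (hphib1 : analytic_in U phib1)
  (hphim1 : analytic_in U phim1) (hphit2 : analytic_in U phit2)
  (hphib2 : analytic_in U phib2) (hphim2 : analytic_in U phim2)
  (ht1 : forall z : R, 1 <= z <= M%:R + N.-1%:R * theta ->
     phit1 z%:C / phim1 z%:C = (w (z - 1) / w z)%:C)
  (hb1 : forall z : R, theta + 1 <= z <= M%:R + N.-1%:R * theta ->
     phib1 z%:C / phim1 z%:C = (tau z / tau (z - 1))%:C)
  (ht2 : forall z : R, 1 <= z <= M%:R + N.-1%:R * theta ->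
     phit2 z%:C / phim2 z%:C = (w z / w (z - 1))%:C)
  (hb2 : forall z : R, theta + 1 <= z <= M%:R + N.-1%:R * theta ->
     phib2 (z - theta)%:C / phim2 (z - theta)%:C = (tau (z - 1) / tau z)%:C)
  (sN : R) (hsN : sN = M%:R + 1 + N.-1%:R * theta)
  (hzt1 : phit1 0 = 0) (hzb1 : phib1 sN%:C = 0) (hzm1 : phim1 sN%:C = 0)
  (hzt2 : phit2 sN%:C = 0) (hzm2 : phim2 0 = 0) (hzb2 : phib2 0 = 0) :
  analytic_up_to_removable U (R1_poles N M theta)
    (R1 N M theta w tau phit1 phib1 phim1) /\
  analytic_up_to_removable U (R2_poles N M theta)
    (R2 N M theta w tau phit2 phib2 phim2).
Proof.
subst sN; have hadm := @prob_admissible R N M theta w tau htheta.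
have p0 := prob_neq0 htheta hw htau.
split.
  exact: (observable_aur htheta htheta1 hadm p0 hw htau hsU hphit1 hphib1 hphim1
    ht1 hb1 hzt1 hzb1 hzm1).
set sN := M%:R + 1 + N.-1%:R * theta in hsU hzt2 *.
pose phi' (f : Cplx R -> Cplx R) := fun x : Cplx R => f (sN%:C - x).
pose U' := [set z : Cplx R | U (sN%:C - z)].
have iB (x y : R) : x%:C - y%:C = (x - y)%:C by rewrite rmorphB.
have aur : analytic_up_to_removable U' (R1_poles N M theta)
    (observable (real_complex R) theta (@prob R N M theta w tau \o @refl N M)
      (phi' phit2) (phi' phib2) (phi' phim2)).
  apply: (observable_aur htheta htheta1 (admissible_refl hadm)).
  - by move=> s /interlacing_refl hs; exact: p0.
  - by move=> x /andP[x0 x1]; apply: hw; apply/andP; split; lra.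
  - by move=> x /andP[x0 x1]; apply: htau; apply/andP; split; lra.
  - move=> x /andP[x0 x1]; rewrite /U' /= iB; apply: hsU.
    by rewrite /sN; apply/andP; split; lra.
  - exact: analytic_in_reflect.
  - exact: analytic_in_reflect.
  - exact: analytic_in_reflect.
  - move=> z /andP[z0 z1]; rewrite /phi' !iB ht2; last by rewrite /sN; apply/andP; split; lra.
    by congr (w _ / w _)%:C; rewrite /sN; ring.
  - move=> z /andP[z0 z1]; rewrite /phi' !iB.
    have -> : sN - z = (M%:R + N.-1%:R * theta + theta - z + 1) - theta.
      by rewrite /sN; ring.
    rewrite hb2; last by apply/andP; split; lra.
    by congr (tau _ / tau _)%:C; ring.
  - by rewrite /phi' subr0.
  - by rewrite /phi' subrr.
  - by rewrite /phi' subrr.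
have aurQ : analytic_up_to_removable U'
    [set z : Cplx R | R2_poles N M theta (sN%:C - z)] _ :=
  aur_sub aur (fun z h => R1_poles_refl h) (fun z _ _ => erefl).
apply: (aur_sub (aur_reflect aurQ) (fun z h => h)) => z _ _.
exact: (esym (@R2E R N M theta w tau phit2 phib2 phim2 z)).
Qed.
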